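(* $\mathrm{PIC}_{cat}$ is an inverse category.
   Context: Rings are associative and unital; the zero ring is allowed, with identity $0$. $Z(\cdot)$ is the center. A unital ideal $I$ of a ring $A$ is a two-sided ideal having a multiplicative identity $1_I$ (then $1_I$ is a central idempotent of $A$ and $I=1_IA$). An inverse category is a category in which for each morphism $g:a\to b$ there is a unique morphism $g^*:b\to a$ with $gg^*g=g$ and $g^*gg^*=g^*$. A set of equivalence data $(I,J,P,Q,\alpha,\beta)$ consists of rings $I,J$, an $I$-$J$-bimodule $P$, a $J$-$I$-bimodule $Q$, an $I$-bimodule isomorphism $\alpha:P\otimes_JQ\to I$ and a $J$-bimodule isomorphism $\beta:Q\otimes_IP\to J$ with $\alpha(p\otimes q)p'=p\beta(q\otimes p')$ and $\beta(q\otimes p)q'=q\alpha(p\otimes q')$ for all $p,p'\in P$, $q,q'\in Q$. In this case there is a unique ring isomorphism $\gamma_P:Z(J)\to Z(I)$ with $\gamma_P(b)p=pb$ for all $p\in P$, $b\in Z(J)$. A set of partial equivalence data $(A,B,I,J,P,Q,\alpha,\beta)$ consists of rings $A,B$, unital ideals $I$ of $A$ and $J$ of $B$, and a set of equivalence data $(I,J,P,Q,\alpha,\beta)$; $P$ is also regarded as an $A$-$B$-bimodule via $ap=(a1_I)p$, $pb=p(1_Jb)$, and similarly $Q$ as a $B$-$A$-bimodule. Write ${}_A^IP_B^J$ for an $I$-$J$-bimodule $P$ with $I,J$ unital ideals of rings $A,B$; it is partially invertible if there are $Q,\alpha,\beta$ such that $(A,B,I,J,P,Q,\alpha,\beta)$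 is a set of partial equivalence data. Put ${}_A^IP_B^J\sim{}_{A'}^{I'}{P'}_{B'}^{J'}$ iff $(A,B,I,J)=(A',B',I',J')$ and $P\cong P'$ as $I$-$J$-bimodules; $[{}_A^IP_B^J]$ is the equivalence class. $\mathrm{PIC}_{cat}$: the objects are all rings; the morphisms are all classes $[{}_A^IP_B^J]$ of partially invertible bimodules, with domain $B$ and codomain $A$; the identity at $A$ is $[{}_A^AA_A^A]$; composition is $[{}_A^IP_B^J][{}_B^{I'}{P'}_C^{J'}]=[{}_A^{I''}(P\otimes_BP')_C^{J''}]$ with $I''=\gamma_P(1_J1_{I'})A$ and $J''=\gamma_{P'}^{-1}(1_J1_{I'})C$. *)

(* Defs.v *)
From HB Require Import structures.
From mathcomp Require Import all_boot all_algebra.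
From mathcomp Require Import boolp classical_sets.
From mathcomp.multinomials Require Import freeg.

Set Implicit Arguments.
Unset Strict Implicit.
Unset Printing Implicit Defensive.

Import GRing.Theory.
Local Open Scope ring_scope.
Local Open Scope quotient_scope.

Local Notation "M ^z" := (zmodule M) (at level 2, format "M ^z") : type_scope.

Reserved Notation "a *> p" (at level 40, left associativity).
Reserved Notation "p <* b" (at level 40, left associativity).

Record bimodule (R S : pzRingType) := Bimodule {
  bim_car :> zmodType;
  lact : R -> bim_car -> bim_car;
  ract : bim_car -> S -> bim_car;
  lact1 : forall p, lact 1 p = p;
  lactA : forall a b p, lact a (lact b p) = lact (a * b) p;
  lactDl : forall a b p, lact (a + b) p = lact a p + lact b p;
  lactDr : forall a p q, lact a (p + q) = lact a p + lact a q;
  ract1 : forall p, ract p 1 = p;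
  ractA : forall p a b, ract (ract p a) b = ract p (a * b);
  ractDr : forall p a b, ract p (a + b) = ract p a + ract p b;
  ractDl : forall p q a, ract (p + q) a = ract p a + ract q a;
  lractA : forall a p b, lact a (ract p b) = ract (lact a p) b
}.
Notation "a *> p" := (lact a p) : ring_scope.
Notation "p <* b" := (ract p b) : ring_scope.

Definition regular (R : pzRingType) : bimodule R R :=
  @Bimodule R R R *%R *%R (@mul1r R) (@mulrA R) (@mulrDl R) (@mulrDr R)
    (@mulr1 R) (fun x y z => esym (mulrA x y z)) (@mulrDr R)
    (fun p q a => mulrDl p q a) (@mulrA R).

Record bimod_iso (R S : pzRingType) (P P' : bimodule R S) (f : P -> P') : Prop :=
  BimodIso {
    biso_add : {morph f : x y / x + y};
    biso_lact : forall a, {morph f : x / a *> x};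
    biso_ract : forall b, {morph f : x / x <* b};
    biso_bij : bijective f }.

Definition isomorphic (R S : pzRingType) (P P' : bimodule R S) : Prop :=
  exists f : P -> P', bimod_iso f.

Section TensorGroup.
Variables (R S T : pzRingType) (P : bimodule R S) (Q : bimodule S T).

Local Notation gen p q := (<< (p, q) >> : {freeg (P * Q)%type / int}).

(* The subgroup of the free abelian group on P x Q by which one divides to get
   the tensor product over S. *)
Inductive tens_rel : {freeg (P * Q)%type / int} -> Prop :=
| TensRel0 : tens_rel 0
| TensRelB x y : tens_rel x -> tens_rel y -> tens_rel (x - y)
| TensRelDl p p' q : tens_rel (gen (p + p') q - (gen p q + gen p' q))
| TensRelDr p q q' : tens_rel (gen p (q + q') - (gen p q + gen p q'))
| TensRelM p s q : tens_rel (gen (p <* s) q - gen p (s *> q)).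

Definition tens_sub : {pred {freeg (P * Q)%type / int}} :=
  fun x => `[< tens_rel x >].

Lemma tens_sub_zmod : zmod_closed tens_sub.
Proof.
split; first by apply/asboolP; exact: TensRel0.
by move=> x y /asboolP hx /asboolP hy; apply/asboolP; exact: TensRelB.
Qed.

HB.instance Definition _ :=
  GRing.isZmodClosed.Build {freeg (P * Q)%type / int} tens_sub tens_sub_zmod.

Definition tens_car : zmodType := {ideal_quot tens_sub}.

Definition pure (p : P) (q : Q) : tens_car := \pi_{ideal_quot tens_sub} (gen p q).


Lemma tens_piD x y : \pi_{ideal_quot tens_sub} (x + y) =
  \pi_{ideal_quot tens_sub} x + \pi_{ideal_quot tens_sub} y :> tens_car.
Proof. by rewrite !piE. Qed.

Lemma tens_pi0 : \pi_{ideal_quot tens_sub} 0 = 0 :> tens_car.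
Proof.
by apply: (addrI (\pi_{ideal_quot tens_sub} 0)); rewrite -tens_piD !addr0.
Qed.

Lemma tens_piN x : \pi_{ideal_quot tens_sub} (- x) =
  - \pi_{ideal_quot tens_sub} x :> tens_car.
Proof. by rewrite !piE. Qed.

Lemma tens_pi_eq x y : tens_rel (x - y) ->
  \pi_{ideal_quot tens_sub} x = \pi_{ideal_quot tens_sub} y.
Proof. by move=> h; apply/eqP; rewrite -Quotient.idealrBE; apply/asboolP. Qed.

Lemma pureDl p p' q : pure (p + p') q = pure p q + pure p' q.
Proof. by rewrite /pure -tens_piD; apply: tens_pi_eq; exact: TensRelDl. Qed.

Lemma pureDr p q q' : pure p (q + q') = pure p q + pure p q'.
Proof. by rewrite /pure -tens_piD; apply: tens_pi_eq; exact: TensRelDr. Qed.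

Lemma pureM p s q : pure (p <* s) q = pure p (s *> q).
Proof. by apply: tens_pi_eq; exact: TensRelM. Qed.

Lemma pure0l q : pure 0 q = 0.
Proof. by apply: (addrI (pure 0 q)); rewrite -pureDl !addr0. Qed.

Lemma pure0r p : pure p 0 = 0.
Proof. by apply: (addrI (pure p 0)); rewrite -pureDr !addr0. Qed.

Lemma pureNl p q : pure (- p) q = - pure p q.
Proof. by apply/eqP; rewrite -addr_eq0 -pureDl addNr pure0l. Qed.

Lemma tens_ind (K : tens_car -> Prop) :
  K 0 -> (forall p q, K (pure p q)) -> (forall x y, K x -> K y -> K (x + y)) ->
  forall x, K x.
Proof.
move=> K0 Kp KD; elim/quotW=> x; elim/freeg_ind_dom0: x => [|k [p q] D _ _ IH].
  by rewrite tens_pi0.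
rewrite tens_piD; apply: (KD) => // {D IH}.
suff Kn (n : nat) :
    K (\pi_{ideal_quot tens_sub} << n%:Z *g (p, q) >>) /\
    K (\pi_{ideal_quot tens_sub} << - n%:Z *g (p, q) >>).
  by case: (intP k) => [|n|n]; [case: (Kn 0%N)|case: (Kn n.+1)|case: (Kn n.+1)].
elim: n => [|n [IH1 IH2]].
  by split; rewrite [X in << X *g _ >>](_ : _ = 0) // freegU0 tens_pi0.
rewrite -addn1 PoszD opprD -!freegUD !tens_piD; split; apply: (KD) => //.
  exact: Kp.
by rewrite -freegUN tens_piN -[X in K (- X)]/(pure p q) -pureNl; apply: (Kp).
Qed.

Record balanced (V : zmodType) (f : P -> Q -> V) : Prop := Balanced {
  balDl : forall p p' q, f (p + p') q = f p q + f p' q;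
  balDr : forall p q q', f p (q + q') = f p q + f p q';
  balM : forall p s q, f (p <* s) q = f p (s *> q) }.

(* The factorization of f through the tensor product; it is meaningful only when
   f is balanced, see tlift_pure and tliftD. *)
Definition tlift (V : zmodType) (f : P -> Q -> V) (x : tens_car) : V :=
  fglift (fun u : P * Q => f u.1 u.2 : V^z) (repr x).

Section Lift.
Variables (V : zmodType) (f : P -> Q -> V) (hf : balanced f).

Lemma tlift_pi x : tlift f (\pi_{ideal_quot tens_sub} x) =
   fglift (fun u : P * Q => f u.1 u.2 : V^z) x.
Proof.
rewrite /tlift; set g := fglift _.
have gB : {morph g : x y / x - y} := @lift_is_additive _ _ _ _.
have g0 : g 0 = 0 by rewrite -(subrr 0) gB subrr.
have gN y : g (- y) = - g y by rewrite -sub0r gB g0 sub0r.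
have gD y z : g (y + z) = g y + g z by rewrite -[z in LHS]opprK gB gN opprK.
apply/eqP; rewrite -subr_eq0 -gB; apply/eqP.
have : tens_rel (repr (\pi_{ideal_quot tens_sub} x) - x).
  apply/asboolP; rewrite -[`[< _ >]]/((_ - x) \in tens_sub).
  by rewrite Quotient.idealrBE reprK.
have gU p q : g << (p, q) >> = f p q by rewrite /g liftU scale1r.
elim=> [|y z _ hy _ hz|p p' q|p q q'|p s q] //.
- by rewrite gB hy hz subrr.
- by rewrite gB gD !gU (balDl hf) subrr.
- by rewrite gB gD !gU (balDr hf) subrr.
- by rewrite gB !gU (balM hf) subrr.
Qed.

Lemma tlift_pure p q : tlift f (pure p q) = f p q.
Proof. by rewrite tlift_pi liftU scale1r. Qed.

Lemma tliftD : {morph tlift f : x y / x + y}.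
Proof.
elim/quotW=> x; elim/quotW=> y; rewrite -tens_piD !tlift_pi.
set g := fglift _.
have gB : {morph g : x y / x - y} := @lift_is_additive _ _ _ _.
have g0 : g 0 = 0 by rewrite -(subrr 0) gB subrr.
have gN z : g (- z) = - g z by rewrite -sub0r gB g0 sub0r.
by rewrite -[y in LHS]opprK gB gN opprK.
Qed.

End Lift.
End TensorGroup.

Section BimoduleTheory.
Variables (R S : pzRingType) (P : bimodule R S).

Lemma lact0 (a : R) : a *> (0 : P) = 0.
Proof. by apply: (addrI (a *> (0 : P))); rewrite -lactDr !addr0. Qed.

Lemma ract0 (b : S) : (0 : P) <* b = 0.
Proof. by apply: (addrI ((0 : P) <* b)); rewrite -ractDl !addr0. Qed.

Lemma lact0r (p : P) : 0 *> p = 0.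
Proof. by apply: (addrI (0 *> p)); rewrite -lactDl !addr0. Qed.

Lemma ract0r (p : P) : p <* 0 = 0.
Proof. by apply: (addrI (p <* 0)); rewrite -ractDr !addr0. Qed.

Lemma lact_suml (I : Type) (s : seq I) (F : I -> R) (p : P) :
  (\sum_(i <- s) F i) *> p = \sum_(i <- s) F i *> p.
Proof. exact: (big_morph (fun a => a *> p) (fun a b => lactDl a b p) (lact0r p)). Qed.

Lemma ract_sumr (I : Type) (s : seq I) (F : I -> S) (p : P) :
  p <* (\sum_(i <- s) F i) = \sum_(i <- s) p <* F i.
Proof. exact: (big_morph (fun a => p <* a) (fun a b => ractDr p a b) (ract0r p)). Qed.

Lemma lact_sumr (I : Type) (s : seq I) (F : I -> P) (a : R) :
  a *> (\sum_(i <- s) F i) = \sum_(i <- s) a *> F i.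
Proof. exact: (big_morph (fun p => a *> p) (lactDr a) (lact0 a)). Qed.

Lemma ract_suml (I : Type) (s : seq I) (F : I -> P) (b : S) :
  (\sum_(i <- s) F i) <* b = \sum_(i <- s) F i <* b.
Proof. exact: (big_morph (fun p => p <* b) (fun p q => ractDl p q b) (ract0 b)). Qed.

Lemma isomorphic_refl : isomorphic P P.
Proof. by exists id; split=> //; exists id. Qed.

End BimoduleTheory.

Lemma isomorphic_sym R S (P P' : bimodule R S) : isomorphic P P' -> isomorphic P' P.
Proof.
case=> f [fD fl fr [g fK gK]]; exists g; split; last by exists f.
- by move=> x y; apply: (can_inj fK); rewrite fD !gK.
- by move=> a x; apply: (can_inj fK); rewrite fl !gK.
- by move=> a x; apply: (can_inj fK); rewrite fr !gK.
Qed.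

Lemma isomorphic_trans R S (P1 P2 P3 : bimodule R S) :
  isomorphic P1 P2 -> isomorphic P2 P3 -> isomorphic P1 P3.
Proof.
case=> f [fD fl fr fb] [g [gD gl gr gb]]; exists (g \o f); split=> /=.
- by move=> x y; rewrite /= fD gD.
- by move=> a x; rewrite /= fl gl.
- by move=> a x; rewrite /= fr gr.
- exact: bij_comp.
Qed.

Section Tensor.
Variables (R S T : pzRingType) (P : bimodule R S) (Q : bimodule S T).

Definition tens_lact (a : R) : tens_car P Q -> tens_car P Q :=
  tlift (fun p q => pure (a *> p) q).

Definition tens_ract (x : tens_car P Q) (b : T) : tens_car P Q :=
  tlift (fun p q => pure p (q <* b)) x.

Lemma tens_lact_bal a : balanced (fun p q => pure (a *> p) q : tens_car P Q).
Proof.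
split=> [p p' q|p q q'|p s q]; first by rewrite lactDr pureDl.
- by rewrite pureDr.
- by rewrite lractA pureM.
Qed.

Lemma tens_ract_bal b : balanced (fun p q => pure p (q <* b) : tens_car P Q).
Proof.
split=> [p p' q|p q q'|p s q]; first by rewrite pureDl.
- by rewrite ractDl pureDr.
- by rewrite pureM lractA.
Qed.

Lemma tens_lact_pure a p q : tens_lact a (pure p q) = pure (a *> p) q.
Proof. exact: (tlift_pure (tens_lact_bal a)). Qed.

Lemma tens_ract_pure p q b : tens_ract (pure p q) b = pure p (q <* b).
Proof. exact: (tlift_pure (tens_ract_bal b)). Qed.

Lemma tens_lactD a x y : tens_lact a (x + y) = tens_lact a x + tens_lact a y.
Proof. exact: (tliftD (tens_lact_bal a)). Qed.

Lemma tens_ractD x y b : tens_ract (x + y) b = tens_ract x b + tens_ract y b.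
Proof. exact: (tliftD (tens_ract_bal b)). Qed.

Lemma tens_lact0 a : tens_lact a 0 = 0.
Proof. by apply: (addrI (tens_lact a 0)); rewrite -tens_lactD !addr0. Qed.

Lemma tens_ract0 b : tens_ract 0 b = 0.
Proof. by apply: (addrI (tens_ract 0 b)); rewrite -tens_ractD !addr0. Qed.

Lemma tens_lact1 x : tens_lact 1 x = x.
Proof.
elim/tens_ind: x => [|p q|x y hx hy]; first exact: tens_lact0.
  by rewrite tens_lact_pure lact1.
by rewrite tens_lactD hx hy.
Qed.

Lemma tens_lactA a b x : tens_lact a (tens_lact b x) = tens_lact (a * b) x.
Proof.
elim/tens_ind: x => [|p q|x y hx hy]; first by rewrite !tens_lact0.
  by rewrite !tens_lact_pure lactA.
by rewrite !tens_lactD hx hy.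
Qed.

Lemma tens_lactDl a b x : tens_lact (a + b) x = tens_lact a x + tens_lact b x.
Proof.
elim/tens_ind: x => [|p q|x y hx hy]; first by rewrite !tens_lact0 addr0.
  by rewrite !tens_lact_pure lactDl pureDl.
by rewrite !tens_lactD hx hy addrACA.
Qed.

Lemma tens_ract1 x : tens_ract x 1 = x.
Proof.
elim/tens_ind: x => [|p q|x y hx hy]; first exact: tens_ract0.
  by rewrite tens_ract_pure ract1.
by rewrite tens_ractD hx hy.
Qed.

Lemma tens_ractA x a b : tens_ract (tens_ract x a) b = tens_ract x (a * b).
Proof.
elim/tens_ind: x => [|p q|x y hx hy]; first by rewrite !tens_ract0.
  by rewrite !tens_ract_pure ractA.
by rewrite !tens_ractD hx hy.
Qed.

Lemma tens_ractDr x a b : tens_ract x (a + b) = tens_ract x a + tens_ract x b.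
Proof.
elim/tens_ind: x => [|p q|x y hx hy]; first by rewrite !tens_ract0 addr0.
  by rewrite !tens_ract_pure ractDr pureDr.
by rewrite !tens_ractD hx hy addrACA.
Qed.

Lemma tens_lractA a x b : tens_lact a (tens_ract x b) = tens_ract (tens_lact a x) b.
Proof.
elim/tens_ind: x => [|p q|x y hx hy].
- by rewrite !(tens_lact0, tens_ract0).
- by rewrite !(tens_lact_pure, tens_ract_pure).
by rewrite !(tens_lactD, tens_ractD) hx hy.
Qed.

Definition tensor : bimodule R T :=
  Bimodule tens_lact1 tens_lactA tens_lactDl tens_lactD
    tens_ract1 tens_ractA tens_ractDr tens_ractD tens_lractA.

Lemma lact_pure a p q : a *> (pure p q : tensor) = pure (a *> p) q.
Proof. exact: tens_lact_pure. Qed.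

Lemma ract_pure p q b : (pure p q : tensor) <* b = pure p (q <* b).
Proof. exact: tens_ract_pure. Qed.

Lemma tens_sumP (x : tensor) :
  exists s : seq (P * Q), x = \sum_(u <- s) pure u.1 u.2.
Proof.
elim/tens_ind: x => [|p q|x y [s ->] [t ->]].
- by exists [::]; rewrite big_nil.
- by exists [:: (p, q)]; rewrite big_seq1.
- by exists (s ++ t); rewrite big_cat.
Qed.

End Tensor.

Lemma tensor_isomorphic R S T (P P' : bimodule R S) (Q Q' : bimodule S T) :
  isomorphic P P' -> isomorphic Q Q' -> isomorphic (tensor P Q) (tensor P' Q').
Proof.
move=> [f [fD fl fr [f' fK f'K]]] [g [gD gl gr [g' gK g'K]]].
have [h [hD hp]] : exists h : tensor P Q -> tensor P' Q',
    {morph h : x y / x + y} /\ forall p q, h (pure p q) = pure (f p) (g q).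
  have hb : balanced (fun p q => pure (f p) (g q) : tensor P' Q').
    split=> [p p' q|p q q'|p s q]; first by rewrite fD pureDl.
    - by rewrite gD pureDr.
    - by rewrite fr gl pureM.
  by eexists; split; [exact: (tliftD hb)|exact: (tlift_pure hb)].
have [k [kD kp]] : exists k : tensor P' Q' -> tensor P Q,
    {morph k : x y / x + y} /\ forall p q, k (pure p q) = pure (f' p) (g' q).
  have kb : balanced (fun p q => pure (f' p) (g' q) : tensor P Q).
    split=> [p p' q|p q q'|p s q].
    - by rewrite -pureDl; congr pure; apply: (can_inj fK); rewrite fD !f'K.
    - by rewrite -pureDr; congr pure; apply: (can_inj gK); rewrite gD !g'K.
    - have -> : f' (p <* s) = f' p <* s by apply: (can_inj fK); rewrite fr !f'K.
      have -> : g' (s *> q) = s *> g' q by apply: (can_inj gK); rewrite gl !g'K.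
      by rewrite pureM.
  by eexists; split; [exact: (tliftD kb)|exact: (tlift_pure kb)].
have h0 : h 0 = 0 by apply: (addrI (h 0)); rewrite -hD !addr0.
have k0 : k 0 = 0 by apply: (addrI (k 0)); rewrite -kD !addr0.
exists h; split=> //.
- move=> a x; elim/tens_ind: x => [|p q|x y hx hy].
  + by rewrite lact0 h0 lact0.
  + by rewrite lact_pure !hp fl lact_pure.
  + by rewrite lactDr !hD hx hy lactDr.
- move=> a x; elim/tens_ind: x => [|p q|x y hx hy].
  + by rewrite ract0 h0 ract0.
  + by rewrite ract_pure !hp gr ract_pure.
  + by rewrite ractDl !hD hx hy ractDl.
exists k => x; elim/tens_ind: x => [|p q|x y hx hy].
- by rewrite h0 k0.
- by rewrite hp kp fK gK.
- by rewrite hD kD hx hy.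
- by rewrite k0 h0.
- by rewrite kp hp f'K g'K.
- by rewrite kD hD hx hy.
Qed.

Definition center (R : pzRingType) : {pred R} :=
  fun z => `[< forall x, z * x = x * z >].

Arguments center : clear implicits.

Lemma centerP (R : pzRingType) (z : R) :
  reflect (forall x, z * x = x * z) (z \in center R).
Proof. exact: asboolP. Qed.

Lemma center_subring (R : pzRingType) : subring_closed (center R).
Proof.
split=> [|x y /centerP hx /centerP hy|x y /centerP hx /centerP hy].
- by apply/centerP => x; rewrite mul1r mulr1.
- by apply/centerP => z; rewrite mulrBl mulrBr hx hy.
- by apply/centerP => z; rewrite -mulrA hy !mulrA hx.
Qed.

HB.instance Definition _ R :=
  GRing.isSubringClosed.Build R (center R) (@center_subring R).

Record center_of (R : pzRingType) := Center {
  center_val : R;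
  center_valP : center_val \in center R }.

HB.instance Definition _ R := [isSub for @center_val R].
HB.instance Definition _ R := [Choice of center_of R by <:].
HB.instance Definition _ R :=
  GRing.SubChoice_isSubPzRing.Build R (center R) (center_of R) (@center_subring R).

Notation "''Z' ( R )" := (center_of R) : type_scope.

Lemma center_comm (R : pzRingType) (z : 'Z(R)) (x : R) : val z * x = x * val z.
Proof. exact/centerP/center_valP. Qed.

Definition is_equiv_data (I J : pzRingType) (P : bimodule I J) (Q : bimodule J I)
    (alpha : tensor P Q -> regular I) (beta : tensor Q P -> regular J) : Prop :=
  [/\ bimod_iso alpha, bimod_iso beta,
      forall p q p', (alpha (pure p q) : I) *> p' = p <* (beta (pure q p') : J)
    & forall q p q', (beta (pure q p) : J) *> q' = q <* (alpha (pure p q') : I)].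

Definition invertible (I J : pzRingType) (P : bimodule I J) : Prop :=
  exists (Q : bimodule J I) (alpha : tensor P Q -> regular I)
    (beta : tensor Q P -> regular J), is_equiv_data alpha beta.

Definition is_gamma (I J : pzRingType) (P : bimodule I J)
    (g : {rmorphism 'Z(J) -> 'Z(I)}) : Prop :=
  bijective g /\ forall (b : 'Z(J)) (p : P), val (g b) *> p = p <* val b.

Record is_pairing (R S : pzRingType) (P : bimodule R S) (Q : bimodule S R)
    (a : P -> Q -> R) : Prop := IsPairing {
  prDl : forall p p' q, a (p + p') q = a p q + a p' q;
  prDr : forall p q q', a p (q + q') = a p q + a p q';
  prM : forall p s q, a (p <* s) q = a p (s *> q);
  prl : forall r p q, a (r *> p) q = r * a p q;
  prr : forall p q r, a p (q <* r) = a p q * r }.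

Record morita_ctx (R S : pzRingType) (P : bimodule R S) (Q : bimodule S R)
    (a : P -> Q -> R) (b : Q -> P -> S) : Prop := MoritaCtx {
  mca : is_pairing a;
  mcb : is_pairing b;
  mcab : forall p q p', a p q *> p' = p <* b q p';
  mcba : forall q p q', b q p *> q' = q <* a p q' }.

Definition attains (R : pzRingType) (P Q : Type) (a : P -> Q -> R) (r : R) : Prop :=
  exists s : seq (P * Q), r = \sum_(u <- s) a u.1 u.2.

Lemma pairing_bal (R S : pzRingType) (P : bimodule R S) (Q : bimodule S R)
  (a : P -> Q -> R) : is_pairing a -> balanced a.
Proof. by case. Qed.

Lemma pairing_lift (R S : pzRingType) (P : bimodule R S) (Q : bimodule S R)
    (a : P -> Q -> R) (ha : is_pairing a) : exists al : tensor P Q -> regular R,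
  [/\ {morph al : x y / x + y}, forall r, {morph al : x / r *> x},
      forall r, {morph al : x / x <* r} & forall p q, al (pure p q) = a p q].
Proof.
have hb := pairing_bal ha; pose al : tensor P Q -> regular R := tlift a.
have hD : {morph al : x y / x + y} := tliftD hb.
have hp p q : al (pure p q) = a p q := tlift_pure hb p q.
have h0 : al 0 = 0 by apply: (addrI (al 0)); rewrite -hD !addr0.
exists al; split=> // r x; elim/tens_ind: x => [|p q|x y hx hy].
- by rewrite lact0 h0 lact0.
- by rewrite lact_pure !hp (prl ha).
- by rewrite lactDr !hD hx hy lactDr.
- by rewrite ract0 h0 ract0.
- by rewrite ract_pure !hp (prr ha).
- by rewrite ractDl !hD hx hy ractDl.
Qed.

Lemma equiv_data_ctx (I J : pzRingType) (P : bimodule I J) (Q : bimodule J I)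
    (alpha : tensor P Q -> regular I) (beta : tensor Q P -> regular J) :
  is_equiv_data alpha beta ->
  let a p q : I := alpha (pure p q) in let b q p : J := beta (pure q p) in
  [/\ morita_ctx a b, attains a 1 & attains b 1].
Proof.
case=> -[aD al ar ab] [bD bl br bb] hab hba a b.
have att R S T (P1 : bimodule R S) (Q1 : bimodule S T) (V : pzRingType)
    (f : tensor P1 Q1 -> V) :
    {morph f : x y / x + y} -> bijective f -> attains (fun p q => f (pure p q)) 1.
  move=> fD [g fK gK]; have [s es] := tens_sumP (g 1); exists s.
  have f0 : f 0 = 0 by apply: (addrI (f 0)); rewrite -fD !addr0.
  by rewrite -(gK 1) es (big_morph f fD f0).
split; [split=> //|exact: att|exact: att]; rewrite /a /b; split=> *.
- by rewrite -aD pureDl.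
- by rewrite -aD pureDr.
- by rewrite pureM.
- by rewrite -lact_pure al.
- by rewrite -ract_pure ar.
- by rewrite -bD pureDl.
- by rewrite -bD pureDr.
- by rewrite pureM.
- by rewrite -lact_pure bl.
- by rewrite -ract_pure br.
Qed.

Lemma ctx_bij (R S : pzRingType) (P : bimodule R S) (Q : bimodule S R)
    (a : P -> Q -> R) (b : Q -> P -> S) (al : tensor P Q -> regular R) :
  morita_ctx a b -> attains a 1 -> {morph al : x y / x + y} ->
  (forall r, {morph al : x / r *> x}) ->
  (forall p q, al (pure p q) = a p q) -> bijective al.
Proof.
move=> [ha hb hab hba] [s es] aD aL ap.
have a0 : al 0 = 0 by apply: (addrI (al 0)); rewrite -aD !addr0.
have key (x : tensor P Q) (u : P) (v : Q) : x <* a u v = pure ((al x : R) *> u) v.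
  elim/tens_ind: x => [|p q|x y hx hy].
  - by rewrite ract0 a0 lact0r pure0l.
  - by rewrite ract_pure ap hab pureM hba.
  - by rewrite ractDl hx hy aD lactDl pureDl.
exists (fun r : regular R => \sum_(u <- s) r *> (pure u.1 u.2 : tensor P Q)).
- move=> x; rewrite -[RHS]ract1 es ract_sumr.
  by apply: eq_bigr => u _; rewrite key lact_pure.
- move=> r; rewrite (big_morph al aD a0) -[RHS]mulr1 es mulr_sumr.
  by apply: eq_bigr => u _; rewrite aL ap.
Qed.

Lemma ctx_invertible (R S : pzRingType) (P : bimodule R S) (Q : bimodule S R)
    (a : P -> Q -> R) (b : Q -> P -> S) :
  morita_ctx a b -> attains a 1 -> attains b 1 -> invertible P.
Proof.
move=> h sa sb; have [ha hb hab hba] := h.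
have [al [aD aL aR ap]] := pairing_lift ha.
have [be [bD bL bR bp]] := pairing_lift hb.
exists Q, al, be; split.
- by split=> //; apply: (ctx_bij h).
- by split=> //; apply: (@ctx_bij _ _ Q P b a).
- by move=> p q p'; rewrite ap bp hab.
- by move=> p q p'; rewrite ap bp hba.
Qed.

Section Gamma.
Variables (R S : pzRingType) (P : bimodule R S).

Lemma invertible_faithful : invertible P ->
  (forall r r' : R, (forall p : P, r *> p = r' *> p) -> r = r') /\
  (forall s s' : S, (forall p : P, p <* s = p <* s') -> s = s').
Proof.
case=> [Q [al [be /equiv_data_ctx/=]]].
set a := fun p q => al _; set b := fun q p => be _ => -[[ha hb _ _] [s es] [t et]].
split=> [r r' h|r r' h].
  rewrite -[r]mulr1 -[r']mulr1 es !mulr_sumr; apply: eq_bigr => u _.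
  by rewrite -!(prl ha) h.
rewrite -[r]mul1r -[r']mul1r et !mulr_suml; apply: eq_bigr => u _.
by rewrite -!(prr hb) h.
Qed.

Lemma gamma_exists : invertible P -> exists g, is_gamma P g.
Proof.
move=> iP; have [fl fr] := invertible_faithful iP.
case: iP => [Q [al [be /equiv_data_ctx/=]]].
set a := fun p q => al _; set b := fun q p => be _ => -[[ha hb hab hba] [s es] [t et]].
have exg (c : 'Z(S)) : exists d : 'Z(R), forall p : P, val d *> p = p <* val c.
  pose d : R := \sum_(u <- s) a (u.1 <* val c) u.2.
  have dP (p : P) : d *> p = p <* val c.
    rewrite lact_suml -[in RHS](lact1 p) es lact_suml ract_suml.
    by apply: eq_bigr => u _; rewrite !hab !ractA center_comm.
  suff dZ : d \in center R by exists (Center dZ).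
  by apply/centerP => x; apply: fl => p; rewrite -!lactA !dP lractA.
have exh (d : 'Z(R)) : exists c : 'Z(S), forall p : P, val d *> p = p <* val c.
  pose c : S := \sum_(u <- t) b u.1 (val d *> u.2).
  have cP (p : P) : val d *> p = p <* c.
    rewrite ract_sumr -[in LHS](ract1 p) et ract_sumr lact_sumr.
    by apply: eq_bigr => u _; rewrite -!hab !lactA center_comm.
  suff cZ : c \in center S by exists (Center cZ).
  by apply/centerP => x; apply: fr => p; rewrite -!ractA -!cP -lractA.
have [g gP] := choice exg; have [h hP] := choice exh.
have gB : zmod_morphism g.
  move=> x y; apply: val_inj; apply: fl => p; rewrite gP.
  apply: (addIr (p <* val y)); rewrite -[in RHS]gP -ractDr -lactDl !subrK.
  by rewrite gP.
have gM : monoid_morphism g.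
  split=> [|x y]; apply: val_inj; apply: fl => p; rewrite gP.
    by rewrite lact1 ract1.
  by rewrite !rmorphM /= -lactA !gP ractA center_comm.
pose gr : {rmorphism 'Z(S) -> 'Z(R)} := HB.pack g
  (GRing.isZmodMorphism.Build _ _ g gB) (GRing.isMonoidMorphism.Build _ _ g gM).
exists gr; split; last exact: gP.
exists h => x; apply: val_inj.
  by apply: fr => p; rewrite -hP gP.
by apply: fl => p; rewrite gP hP.
Qed.

Lemma gamma_uniq g g' : invertible P ->
  is_gamma P g -> is_gamma P g' -> g =1 g'.
Proof.
move=> /invertible_faithful[fl _] [_ gP] [_ g'P] c.
by apply: val_inj; apply: fl => p; rewrite gP g'P.
Qed.

End Gamma.

(* The carrier determines the identity: see uideal_ext. *)
Record uideal (A : pzRingType) := UIdeal {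
  uset : {pred A};
  uone : A;
  uideal_zmod : zmod_closed uset;
  uidealMl : forall a x, x \in uset -> a * x \in uset;
  uidealMr : forall x a, x \in uset -> x * a \in uset;
  uone_in : uone \in uset;
  uone_mull : forall x, x \in uset -> uone * x = x;
  uone_mulr : forall x, x \in uset -> x * uone = x }.

Lemma uideal_ext (A : pzRingType) (I I' : uideal A) : uset I =i uset I' -> I = I'.
Proof.
case: I I' => [S e z1 l1 r1 i1 ml1 mr1] [S' e' z2 l2 r2 i2 ml2 mr2] /= h.
have eS : S = S' by apply/funext.
move: S' eS z2 l2 r2 i2 ml2 mr2 h => _ <- z2 l2 r2 i2 ml2 mr2 _.
have ee : e = e' by rewrite -(ml2 e i1) mr1.
move: e' ee i2 ml2 mr2 => _ <- i2 ml2 mr2.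
by congr UIdeal; exact: Prop_irrelevance.
Qed.

Lemma uone_center (A : pzRingType) (I : uideal A) : uone I \in center A.
Proof.
apply/centerP => x; rewrite -(uone_mulr (uidealMr x (uone_in I))).
by rewrite -mulrA uone_mull // uidealMl ?uone_in.
Qed.

HB.instance Definition _ (A : pzRingType) (I : uideal A) :=
  GRing.isZmodClosed.Build A (uset I) (uideal_zmod I).

Record isub (A : pzRingType) (I : uideal A) := ISub {
  isub_val : A;
  isub_valP : isub_val \in uset I }.

HB.instance Definition _ (A : pzRingType) (I : uideal A) :=
  [isSub for @isub_val A I].
HB.instance Definition _ (A : pzRingType) (I : uideal A) :=
  [Choice of isub I by <:].
HB.instance Definition _ (A : pzRingType) (I : uideal A) :=
  [SubChoice_isSubZmodule of isub I by <:].

Section IdealRing.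
Variables (A : pzRingType) (I : uideal A).

Definition isub_one : isub I := ISub (uone_in I).
Definition isub_mul (x y : isub I) : isub I := ISub (uidealMl (val x) (isub_valP y)).

Lemma isub_mulA : associative isub_mul.
Proof. by move=> x y z; apply: val_inj; rewrite /= mulrA. Qed.

Lemma isub_mul1r : left_id isub_one isub_mul.
Proof. by move=> x; apply: val_inj; rewrite /= uone_mull ?isub_valP. Qed.

Lemma isub_mulr1 : right_id isub_one isub_mul.
Proof. by move=> x; apply: val_inj; rewrite /= uone_mulr ?isub_valP. Qed.

Lemma isub_mulDl : left_distributive isub_mul +%R.
Proof. by move=> x y z; apply: val_inj; rewrite /= mulrDl. Qed.

Lemma isub_mulDr : right_distributive isub_mul +%R.
Proof. by move=> x y z; apply: val_inj; rewrite /= mulrDr. Qed.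

HB.instance Definition _ := GRing.Zmodule_isPzRing.Build (isub I)
  isub_mulA isub_mul1r isub_mulr1 isub_mulDl isub_mulDr.

Lemma val_isubM (x y : isub I) : val (x * y) = val x * val y.
Proof. by []. Qed.

Lemma val_isub1 : val (1 : isub I) = uone I.
Proof. by []. Qed.

Lemma isub_uone (x : isub I) : val x * uone I = val x.
Proof. by rewrite uone_mulr ?isub_valP. Qed.

(* 1_I is central, so that a * 1_I = 1_I * a; uproj defines both actions in
   extend: a p = (a 1_I) p and p b = p (1_J b). *)
Definition uproj (a : A) : isub I := ISub (uidealMl a (uone_in I)).

Lemma uproj_zmod : zmod_morphism uproj.
Proof. by move=> x y; apply: val_inj; rewrite /= mulrBl. Qed.

Lemma uproj_monoid : monoid_morphism uproj.
Proof.
split=> [|x y]; apply: val_inj; rewrite /= ?mul1r //.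
by rewrite mulrA -[x * _ * y]mulrA (centerP _ (uone_center I)) -!mulrA
  (uone_mulr (uone_in I)).
Qed.

HB.instance Definition _ := GRing.isZmodMorphism.Build A (isub I) uproj uproj_zmod.
HB.instance Definition _ :=
  GRing.isMonoidMorphism.Build A (isub I) uproj uproj_monoid.

Lemma uprojK (x : isub I) : uproj (val x) = x.
Proof. by apply: val_inj; rewrite /= isub_uone. Qed.

Lemma uproj_uone : uproj (uone I) = 1.
Proof. by apply: val_inj; exact: (uone_mulr (uone_in I)). Qed.

Lemma val_center (z : 'Z(isub I)) : val (val z) \in center A.
Proof.
apply/centerP => x; rewrite -[in LHS]isub_uone -[in RHS]isub_uone.
have := congr1 val (center_comm z (uproj x)); rewrite !val_isubM /= => h.
rewrite -[LHS]mulrA (centerP _ (uone_center I)) h.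
by rewrite -!mulrA (centerP _ (uone_center I)).
Qed.

Definition center_in (e : A) (eI : e \in uset I) (ec : e \in center A) : 'Z(isub I).
Proof.
exists (ISub eI); apply/centerP => x; apply: val_inj.
exact: (centerP _ ec).
Defined.

Section PrincipalIdeal.
Variables (z : 'Z(isub I)) (zz : z * z = z).
Let e := val (val z).

(* The set e A, for a central idempotent e of A given as a central idempotent of
   a unital ideal of A. *)
Definition central_set : {pred A} := fun x => `[< exists a, x = e * a >].

Let ee : e * e = e.
Proof. by rewrite /e -[in RHS]zz rmorphM. Qed.

Lemma central_set_zmod : zmod_closed central_set.
Proof.
split; first by apply/asboolP; exists 0; rewrite mulr0.
move=> x y /asboolP[a ->] /asboolP[b ->]; apply/asboolP.
by exists (a - b); rewrite mulrBr.
Qed.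

Lemma central_setMl a x : x \in central_set -> a * x \in central_set.
Proof.
move=> /asboolP[b ->]; apply/asboolP; exists (a * b).
by rewrite !mulrA (centerP _ (val_center z)).
Qed.

Lemma central_setMr x a : x \in central_set -> x * a \in central_set.
Proof. by move=> /asboolP[b ->]; apply/asboolP; exists (b * a); rewrite mulrA. Qed.

Lemma central_set_one : e \in central_set.
Proof. by apply/asboolP; exists 1; rewrite mulr1. Qed.

Lemma central_set_mul1 x : x \in central_set -> e * x = x.
Proof. by move=> /asboolP[b ->]; rewrite mulrA ee. Qed.

Lemma central_set_mulr1 x : x \in central_set -> x * e = x.
Proof.
by move=> xI; rewrite -(centerP _ (val_center z)) central_set_mul1.
Qed.

Definition central_ideal : uideal A :=
  UIdeal central_set_zmod central_setMl central_setMr central_set_one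
    central_set_mul1 central_set_mulr1.

End PrincipalIdeal.
End IdealRing.

Definition full_ideal (A : pzRingType) : uideal A.
Proof.
exists (fun=> true) 1 => // x _; first exact: mul1r.
exact: mulr1.
Defined.

Definition bimod_pull (A B R S : pzRingType) (f : {rmorphism A -> R})
    (g : {rmorphism B -> S}) (P : bimodule R S) : bimodule A B.
Proof.
apply: (@Bimodule A B P (fun a p => f a *> p) (fun p b => p <* g b)).
- by move=> p; rewrite rmorph1 lact1.
- by move=> a b p; rewrite lactA rmorphM.
- by move=> a b p; rewrite rmorphD lactDl.
- by move=> a p q; rewrite lactDr.
- by move=> p; rewrite rmorph1 ract1.
- by move=> p a b; rewrite ractA rmorphM.
- by move=> p a b; rewrite rmorphD ractDr.
- by move=> p q a; rewrite ractDl.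
- by move=> a p b; rewrite lractA.
Defined.

Definition extend (A B : pzRingType) (I : uideal A) (J : uideal B)
    (P : bimodule (isub I) (isub J)) : bimodule A B :=
  bimod_pull (uproj I : {rmorphism A -> isub I}) (uproj J : {rmorphism B -> isub J}) P.

(* An A-B-bimodule on which 1_I and 1_J act as identities is an I-J-bimodule. *)
Definition restr (A B : pzRingType) (M : bimodule A B) (I : uideal A) (J : uideal B)
    (hl : forall m : M, uone I *> m = m) (hr : forall m : M, m <* uone J = m) :
  bimodule (isub I) (isub J).
Proof.
apply: (@Bimodule (isub I) (isub J) M (fun (a : isub I) m => val a *> m)
  (fun m (b : isub J) => m <* val b)).
- exact: hl.
- by move=> a b p; rewrite lactA.
- by move=> a b p; rewrite lactDl.
- by move=> a p q; rewrite lactDr.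
- exact: hr.
- by move=> p a b; rewrite ractA.
- by move=> p a b; rewrite ractDr.
- by move=> p q a; rewrite ractDl.
- by move=> a p b; rewrite lractA.
Defined.

Lemma isomorphic_extend (A B : pzRingType) (I : uideal A) (J : uideal B)
    (P P' : bimodule (isub I) (isub J)) :
  isomorphic P P' -> isomorphic (extend P) (extend P').
Proof.
case=> f [fD fl fr fb]; exists f; split=> // [a|b] x; first exact: (fl (uproj I a)).
exact: (fr (uproj J b)).
Qed.

Lemma extend_ctx (A B : pzRingType) (I : uideal A) (J : uideal B)
    (P : bimodule (isub I) (isub J)) (Q : bimodule (isub J) (isub I)) a b :
  @morita_ctx _ _ P Q a b ->
  @morita_ctx _ _ (extend P) (extend Q) (fun p q => val (a p q)) (fun q p => val (b q p)).
Proof.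
have pr C D (K : uideal C) (L : uideal D) (P0 : bimodule (isub K) (isub L))
    (Q0 : bimodule (isub L) (isub K)) a0 : @is_pairing _ _ P0 Q0 a0 ->
    @is_pairing _ _ (extend P0) (extend Q0) (fun p q => val (a0 p q)).
  case=> Dl Dr M l r; split=> *; rewrite /= ?Dl ?Dr ?M ?l ?r //.
  - by rewrite val_isubM /= -mulrA uone_mull ?isub_valP.
  - by rewrite val_isubM /= mulrA uone_mulr ?uidealMr ?isub_valP.
case=> ha hb hab hba; split; [exact: pr|exact: pr| |] => *.
  by rewrite /= !uprojK hab.
by rewrite /= !uprojK hba.
Qed.

Section Extend.
Variables (A B : pzRingType) (I : uideal A) (J : uideal B).
Variables (P : bimodule (isub I) (isub J)) (Q : bimodule (isub J) (isub I)).

Lemma extend_lact1 (p : extend P) : uone I *> p = p.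
Proof.
by rewrite -[RHS](lact1 (p : P)) -uproj_uone.
Qed.

Lemma extend_ract1 (p : extend P) : p <* uone J = p.
Proof.
by rewrite -[RHS](ract1 (p : P)) -uproj_uone.
Qed.

Lemma extend_center (g : 'Z(isub J) -> 'Z(isub I)) :
  (forall b (p : P), val (g b) *> p = p <* val b) ->
  forall b (p : extend P), val (val (g b)) *> p = p <* val (val b).
Proof.
by move=> gP b p; have := gP b p; rewrite -{1}[val (g b)]uprojK -{1}[val b]uprojK.
Qed.

Lemma extend_center_op (g : 'Z(isub J) -> 'Z(isub I)) a b :
  @morita_ctx _ _ P Q a b -> attains b 1 ->
  (forall b (p : P), val (g b) *> p = p <* val b) ->
  forall (c : 'Z(isub J)) (q : extend Q), val (val c) *> q = q <* val (val (g c)).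
Proof.
move=> [ha hb hab hba] [t et] gP d q.
suff : val d *> (q : Q) = (q : Q) <* val (g d).
  by rewrite -{1}[val (g d)]uprojK -{1}[val d]uprojK.
rewrite -[LHS]lact1 -[RHS]lact1 et !lact_suml; apply: eq_bigr => u _.
by rewrite !hba -(prM ha) -gP (prl ha) (prr ha) center_comm.
Qed.

End Extend.

Section Restrict.
Variables (A B : pzRingType) (M : bimodule A B) (N : bimodule B A).
Variables (I : uideal A) (J : uideal B).
Variables (hl : forall m : M, uone I *> m = m) (hr : forall m : M, m <* uone J = m).
Variables (kl : forall m : N, uone J *> m = m) (kr : forall m : N, m <* uone I = m).

Lemma restr_invertible a b : @morita_ctx _ _ M N a b ->
  attains a (uone I) -> attains b (uone J) -> invertible (restr hl hr).
Proof.
case=> -[aDl aDr aM al ar] [bDl bDr bM bl br] hab hba [s es] [t et].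
apply: (@ctx_invertible _ _ (restr hl hr) (restr kl kr)
  (fun p q => uproj I (a p q)) (fun q p => uproj J (b q p))).
- split; first split.
  + by move=> *; rewrite aDl rmorphD.
  + by move=> *; rewrite aDr rmorphD.
  + by move=> *; rewrite aM.
  + by move=> r p q; rewrite /= al rmorphM /= uprojK.
  + by move=> p q r; rewrite /= ar rmorphM /= uprojK.
  split.
  + by move=> *; rewrite bDl rmorphD.
  + by move=> *; rewrite bDr rmorphD.
  + by move=> *; rewrite bM.
  + by move=> r p q; rewrite /= bl rmorphM /= uprojK.
  + by move=> p q r; rewrite /= br rmorphM /= uprojK.
  + by move=> p q p'; rewrite /= -lactA hl hab -{1}[p](hr p) ractA
      (centerP _ (uone_center J)).
  + by move=> p q p'; rewrite /= -lactA kl hba -{1}[p](kr p) ractA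
      (centerP _ (uone_center I)).
- exists s; rewrite -rmorph_sum -es; apply: val_inj => /=.
  by rewrite uone_mulr ?uone_in.
- exists t; rewrite -rmorph_sum -et; apply: val_inj => /=.
  by rewrite uone_mulr ?uone_in.
Qed.

End Restrict.

Lemma pairing_suml (R S : pzRingType) (P : bimodule R S) (Q : bimodule S R)
    (a : P -> Q -> R) (T : Type) (s : seq T) (F : T -> P) (q : Q) :
  is_pairing a -> a (\sum_(i <- s) F i) q = \sum_(i <- s) a (F i) q.
Proof.
move=> ha; apply: (big_morph (fun p => a p q) (fun p p' => prDl ha p p' q)).
by apply: (addrI (a 0 q)); rewrite -(prDl ha) !addr0.
Qed.

Lemma comp_pairing (A B C : pzRingType) (P : bimodule A B) (Q : bimodule B A)
    (P' : bimodule B C) (Q' : bimodule C B) (a : P -> Q -> A) (a' : P' -> Q' -> B) :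
  is_pairing a -> is_pairing a' ->
  exists a'' : tensor P P' -> tensor Q' Q -> A, is_pairing a'' /\
    forall p p' q' q, a'' (pure p p') (pure q' q) = a (p <* a' p' q') q.
Proof.
move=> [aDl aDr aM al ar] [aDl' aDr' aM' al' ar'].
have hb p p' : balanced (fun (q' : Q') (q : Q) => a (p <* a' p' q') q).
  split=> [q' q1' q|q' q q1|q' s q].
  - by rewrite aDr' ractDr aDl.
  - by rewrite aDr.
  - by rewrite ar' -ractA aM.
pose h p p' : tensor Q' Q -> A := tlift (fun q' q => a (p <* a' p' q') q).
have hD p p' : {morph h p p' : x y / x + y} := tliftD (hb p p').
have hp p p' q' q : h p p' (pure q' q) = a (p <* a' p' q') q :=
  tlift_pure (hb p p') q' q.
have h0 p p' : h p p' 0 = 0 by apply: (addrI (h p p' 0)); rewrite -hD !addr0.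
have kb y : balanced (fun (p : P) (p' : P') => h p p' y).
  split=> [p p1 p'|p p' p1'|p s p']; elim/tens_ind: y => [|q' q|x y hx hy].
  - by rewrite !h0 addr0.
  - by rewrite !hp ractDl aDl.
  - by rewrite !hD hx hy addrACA.
  - by rewrite !h0 addr0.
  - by rewrite !hp aDl' ractDr aDl.
  - by rewrite !hD hx hy addrACA.
  - by rewrite !h0.
  - by rewrite !hp al' ractA.
  - by rewrite !hD hx hy.
pose k (x : tensor P P') (y : tensor Q' Q) : A := tlift (fun p p' => h p p' y) x.
have kDl x1 x2 y : k (x1 + x2) y = k x1 y + k x2 y := tliftD (kb y) x1 x2.
have kp p p' y : k (pure p p') y = h p p' y := tlift_pure (kb y) p p'.
have k0 y : k 0 y = 0 by apply: (addrI (k 0 y)); rewrite -kDl !addr0.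
have kDr x y1 y2 : k x (y1 + y2) = k x y1 + k x y2.
  elim/tens_ind: x => [|p p'|x1 x2 h1 h2]; first by rewrite !k0 addr0.
    by rewrite !kp hD.
  by rewrite !kDl h1 h2 addrACA.
have k0r x : k x 0 = 0 by apply: (addrI (k x 0)); rewrite -kDr !addr0.
exists k; split; last by move=> *; rewrite kp hp.
split=> //.
- move=> x s y; elim/tens_ind: x => [|p p'|x1 x2 h1 h2].
  + by rewrite ract0 !k0.
  + rewrite ract_pure; elim/tens_ind: y => [|q' q|y1 y2 h1 h2].
    * by rewrite lact0 !k0r.
    * by rewrite lact_pure !kp !hp aM'.
    * by rewrite lactDr !kDr h1 h2.
  + by rewrite ractDl !kDl h1 h2.
- move=> r x y; elim/tens_ind: x => [|p p'|x1 x2 h1 h2].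
  + by rewrite lact0 !k0 mulr0.
  + rewrite lact_pure; elim/tens_ind: y => [|q' q|y1 y2 h1 h2].
    * by rewrite !k0r mulr0.
    * by rewrite !kp !hp -lractA al.
    * by rewrite !kDr h1 h2 mulrDr.
  + by rewrite lactDr !kDl h1 h2 mulrDr.
- move=> x y r; elim/tens_ind: x => [|p p'|x1 x2 h1 h2].
  + by rewrite !k0 mul0r.
  + elim/tens_ind: y => [|q' q|y1 y2 h1 h2].
    * by rewrite ract0 !k0r mul0r.
    * by rewrite ract_pure !kp !hp ar.
    * by rewrite ractDl !kDr h1 h2 mulrDl.
  + by rewrite !kDl h1 h2 mulrDl.
Qed.

Lemma pairing0 (R S : pzRingType) (P : bimodule R S) (Q : bimodule S R)
    (a : P -> Q -> R) : is_pairing a -> (forall q, a 0 q = 0) /\ (forall p, a p 0 = 0).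
Proof.
case=> Dl Dr _ _ _; split=> [q|p].
  by apply: (addrI (a 0 q)); rewrite -Dl !addr0.
by apply: (addrI (a p 0)); rewrite -Dr !addr0.
Qed.

Lemma comp_compat (A B C : pzRingType) (P : bimodule A B) (Q : bimodule B A)
    (P' : bimodule B C) (Q' : bimodule C B) (a : P -> Q -> A) (b : Q -> P -> B)
    (a' : P' -> Q' -> B) (b' : Q' -> P' -> C)
    (a'' : tensor P P' -> tensor Q' Q -> A) (b'' : tensor Q' Q -> tensor P P' -> C) :
  (forall p q p', a p q *> p' = p <* b q p') ->
  (forall p q p', a' p q *> p' = p <* b' q p') ->
  is_pairing b' -> is_pairing a'' -> is_pairing b'' ->
  (forall p p' q' q, a'' (pure p p') (pure q' q) = a (p <* a' p' q') q) ->
  (forall q' q p p', b'' (pure q' q) (pure p p') = b' (q' <* b q p) p') ->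
  forall x y x1, a'' x y *> x1 = x <* b'' y x1.
Proof.
move=> hab hab' hb' ha'' hb'' ea eb.
have [a0l a0r] := pairing0 ha''; have [b0l b0r] := pairing0 hb''.
move=> x y x1; elim/tens_ind: x => [|p p'|x x2 h1 h2].
- by rewrite a0l lact0r ract0.
- elim/tens_ind: y => [|q' q|y y2 h1 h2].
  + by rewrite a0r b0l lact0r ract0r.
  + elim/tens_ind: x1 => [|r r'|x1 x2 h1 h2].
    * by rewrite b0r lact0 ract0r.
    * by rewrite ea eb lact_pure ract_pure hab pureM pureM hab' (prM hb').
    * by rewrite lactDr (prDr hb'') ractDr h1 h2.
  + by rewrite (prDr ha'') (prDl hb'') lactDl ractDr h1 h2.
- by rewrite (prDl ha'') lactDl ractDl h1 h2.
Qed.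

Lemma comp_ctx (A B C : pzRingType) (P : bimodule A B) (Q : bimodule B A)
    (P' : bimodule B C) (Q' : bimodule C B) (a : P -> Q -> A) (b : Q -> P -> B)
    (a' : P' -> Q' -> B) (b' : Q' -> P' -> C) :
  morita_ctx a b -> morita_ctx a' b' ->
  exists (a'' : tensor P P' -> tensor Q' Q -> A) (b'' : tensor Q' Q -> tensor P P' -> C),
   [/\ morita_ctx a'' b'',
      forall p p' q' q, a'' (pure p p') (pure q' q) = a (p <* a' p' q') q &
      forall q' q p p', b'' (pure q' q) (pure p p') = b' (q' <* b q p) p'].
Proof.
move=> [ha hb hab hba] [ha' hb' hab' hba'].
have [a'' [pa ea]] := comp_pairing ha ha'.
have [b'' [pb eb]] := comp_pairing hb' hb.
exists a'', b''; split=> //; split=> //.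
  exact: (comp_compat hab hab').
exact: (comp_compat hba' hba).
Qed.

Record pibimod (A B : pzRingType) := PIBimod {
  pib_I : uideal A;
  pib_J : uideal B;
  pib_P : bimodule (isub pib_I) (isub pib_J);
  pib_inv : invertible pib_P }.

Definition gamma (A B : pzRingType) (X : pibimod A B) :
    {rmorphism 'Z(isub (pib_J X)) -> 'Z(isub (pib_I X))} :=
  projT1 (cid (gamma_exists (pib_inv X))).

Arguments gamma {A B} X.

Lemma gammaP (A B : pzRingType) (X : pibimod A B) : is_gamma (pib_P X) (gamma X).
Proof. exact: (projT2 (cid (gamma_exists (pib_inv X)))). Qed.

Lemma gammaV_exists (A B : pzRingType) (X : pibimod A B) :
  exists h, cancel (gamma X) h /\ cancel h (gamma X).
Proof. by have [[h hK Kh] _] := gammaP X; exists h. Qed.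

Definition gammaV (A B : pzRingType) (X : pibimod A B) :
    'Z(isub (pib_I X)) -> 'Z(isub (pib_J X)) :=
  projT1 (cid (gammaV_exists X)).

Arguments gammaV {A B} X _.

Lemma gammaK A B (X : pibimod A B) : cancel (gamma X) (gammaV X).
Proof. by case: (projT2 (cid (gammaV_exists X))). Qed.

Lemma gammaVK A B (X : pibimod A B) : cancel (gammaV X) (gamma X).
Proof. by case: (projT2 (cid (gammaV_exists X))). Qed.

Arguments gammaP {A B} X.
Arguments gammaK {A B} X _.
Arguments gammaVK {A B} X _.

(* Equality of the rings and the ideals is enforced by the indices. *)
Inductive pib_equiv (A B : pzRingType) : pibimod A B -> pibimod A B -> Prop :=
| PibEquiv (I : uideal A) (J : uideal B) (P P' : bimodule (isub I) (isub J))
    (iP : invertible P) (iP' : invertible P') :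
    isomorphic P P' -> pib_equiv (PIBimod iP) (PIBimod iP').

Lemma pib_equiv_refl A B (X : pibimod A B) : pib_equiv X X.
Proof. by case: X => I J P iP; constructor; exact: isomorphic_refl. Qed.

Lemma pib_equiv_sym A B (X Y : pibimod A B) : pib_equiv X Y -> pib_equiv Y X.
Proof. by case=> I J P P' iP iP' h; constructor; exact: isomorphic_sym. Qed.

Lemma pib_equivP A B (X Y : pibimod A B) : pib_equiv X Y <->
  exists (eI : pib_I X = pib_I Y) (eJ : pib_J X = pib_J Y),
    isomorphic (eq_rect _ (fun I => bimodule (isub I) (isub (pib_J Y)))
       (eq_rect _ (fun J => bimodule (isub (pib_I X)) (isub J)) (pib_P X) _ eJ) _ eI)
      (pib_P Y).
Proof.
split=> [[I J P P' iP iP' h]|]; first by exists erefl, erefl.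
case: X Y => I J P iP [I' J' P' iP'] /= [eI [eJ]].
by case: _ / eI P' iP'; case: _ / eJ => P' iP' /= h; constructor.
Qed.

Lemma pib_equiv_trans A B (X Y Z : pibimod A B) :
  pib_equiv X Y -> pib_equiv Y Z -> pib_equiv X Z.
Proof.
case=> I J P P' iP iP' h /pib_equivP; case: Z => I1 J1 P1 iP1 /= [eI [eJ]].
case: _ / eI P1 iP1; case: _ / eJ => P1 iP1 /= h1.
by constructor; exact: isomorphic_trans h1.
Qed.

Section Composition.
Variables (A B C : pzRingType) (X : pibimod A B) (Y : pibimod B C).
Let J := pib_J X.
Let K := pib_I Y.

Lemma glue_center : uone J * uone K \in center B.
Proof. by rewrite rpredM ?uone_center. Qed.

(* 1_J 1_I' as an element of Z(J) (glueL) and of Z(I') (glueR), where X is an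
   I-J-bimodule and Y an I'-J'-bimodule. *)
Definition glueL : 'Z(isub J) := center_in (uidealMr (uone K) (uone_in J)) glue_center.
Definition glueR : 'Z(isub K) := center_in (uidealMl (uone J) (uone_in K)) glue_center.

Lemma glue_idem : uone J * uone K * (uone J * uone K) = uone J * uone K.
Proof.
rewrite mulrA -[_ * uone J]mulrA -(centerP _ (uone_center J)) mulrA.
by rewrite (uone_mulr (uone_in J)) -mulrA (uone_mulr (uone_in K)).
Qed.

Lemma gamma_glue_idem : gamma X glueL * gamma X glueL = gamma X glueL.
Proof.
by rewrite -rmorphM; congr (gamma X _); do 2!apply: val_inj; exact: glue_idem.
Qed.

Lemma gammaV_glue_idem : gammaV Y glueR * gammaV Y glueR = gammaV Y glueR.
Proof.
apply: (can_inj (gammaK Y)); rewrite rmorphM !gammaVK.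
by do 2!apply: val_inj; exact: glue_idem.
Qed.

Definition comp_I : uideal A := central_ideal gamma_glue_idem.
Definition comp_J : uideal C := central_ideal gammaV_glue_idem.

Let P := extend (pib_P X).
Let P' := extend (pib_P Y).

Lemma glue_pure (p : P) (p' : P') :
  pure (p <* (uone J * uone K)) p' = pure p p' :> tensor P P'.
Proof.
by rewrite -ractA extend_ract1 pureM extend_lact1.
Qed.


Lemma comp_lact1 (m : tensor P P') : uone comp_I *> m = m.
Proof.
elim/tens_ind: m => [|p p'|x y hx hy]; first by rewrite lact0.
  rewrite lact_pure -[RHS]glue_pure; congr pure.
  by have [_ gP] := gammaP X; exact: (extend_center gP glueL p).
by rewrite lactDr hx hy.
Qed.

Lemma comp_ract1 (m : tensor P P') : m <* uone comp_J = m.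
Proof.
elim/tens_ind: m => [|p p'|x y hx hy]; first by rewrite ract0.
  rewrite ract_pure -[RHS]glue_pure [RHS]pureM; congr pure.
  have [_ gP] := gammaP Y; have h := extend_center gP (gammaV Y glueR) p'.
  by rewrite gammaVK in h; rewrite -h.
by rewrite ractDl hx hy.
Qed.

Definition comp_bim : bimodule (isub comp_I) (isub comp_J) :=
  restr comp_lact1 comp_ract1.

Lemma comp_invertible : invertible comp_bim.
Proof.
have [_ gX] := gammaP X; have [_ gY] := gammaP Y.
have gX' := extend_center gX glueL; have gY' := extend_center gY (gammaV Y glueR).
rewrite gammaVK in gY'.
have iX := pib_inv X; have iY := pib_inv Y.
case: (iX) => [Q [al [be /equiv_data_ctx/=]]].
set a0 := fun p q => al _; set b0 := fun q p => be _ => -[cX [sX esX] [tX etX]].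
case: (iY) => [Q' [al' [be' /equiv_data_ctx/=]]].
set a0' := fun p q => al' _; set b0' := fun q p => be' _ => -[cY [sY esY] [tY etY]].
have qX := extend_center_op cX (ex_intro _ tX etX) gX glueL.
have qY := extend_center_op cY (ex_intro _ tY etY) gY (gammaV Y glueR).
rewrite gammaVK in qY.
have eX := extend_ctx cX; have eY := extend_ctx cY.
have [a [b [ctx ea eb]]] := comp_ctx eX eY.
have kl (m : tensor (extend Q') (extend Q)) : uone comp_J *> m = m.
  elim/tens_ind: m => [|p p'|x y hx hy]; first by rewrite lact0.
    by rewrite lact_pure [uone _ *> p]qY -ractA extend_ract1 pureM extend_lact1.
  by rewrite lactDr hx hy.
have kr (m : tensor (extend Q') (extend Q)) : m <* uone comp_I = m.
  elim/tens_ind: m => [|p p'|x y hx hy]; first by rewrite ract0.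
    by rewrite ract_pure -[p' <* _]qX -pureM -ractA extend_ract1 pureM extend_lact1.
  by rewrite ractDl hx hy.
apply: (restr_invertible _ _ kl kr ctx).
- exists [seq (@pure _ _ _ P P' u.1 ((uone J * uone K) *> (v.1 : P')),
    @pure _ _ _ (extend Q') (extend Q) v.2 u.2) | u <- sX, v <- sY].
  rewrite big_allpairs_dep /=.
  have -> : val (val (gamma X glueL)) =
      \sum_(u <- sX) val (a0 (u.1 <* val glueL) u.2).
    rewrite -[LHS]isub_uone -val_isub1 esX raddf_sum mulr_sumr.
    by apply: eq_bigr => u _; rewrite -gX (prl (mca cX)).
  apply: eq_bigr => u _.
  have -> : u.1 <* val glueL = (u.1 : P) <* (uone J * uone K).
    by rewrite -{1}[val glueL]uprojK.
  have eJK : uone J * uone K = \sum_(v <- sY)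
      val (a0' (((uone J * uone K) *> (v.1 : P'))) v.2).
    rewrite -[in LHS](uone_mulr (uone_in K)) mulrA -[X in _ * X = _](@val_isub1 _ K).
    rewrite esY raddf_sum mulr_sumr.
    by apply: eq_bigr => v _; rewrite (prl (mca eY)).
  rewrite [in LHS]eJK ract_sumr.
  rewrite [LHS](pairing_suml _ _ _ (mca eX)); apply: eq_bigr => v _.
  by rewrite ea.
- exists [seq (@pure _ _ _ (extend Q') (extend Q) u.1 v.1,
    @pure _ _ _ P P' v.2 ((uone J * uone K) *> (u.2 : P'))) | u <- tY, v <- tX].
  rewrite big_allpairs_dep /=.
  have -> : val (val (gammaV Y glueR)) =
      \sum_(u <- tY) val (b0' u.1 (val glueR *> u.2)).
    rewrite -[LHS]isub_uone (centerP _ (val_center _)) -val_isub1 etY raddf_sum mulr_suml.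
    apply: eq_bigr => u _.
    by rewrite -[glueR](gammaVK Y) gY (prr (mcb cY)) gammaVK.
  apply: eq_bigr => u _.
  have -> : val glueR *> u.2 = (uone J * uone K) *> (u.2 : P').
    by rewrite -{1}[val glueR]uprojK.
  have eJ : uone J = \sum_(v <- tX) val (b0 v.1 v.2).
    by rewrite -raddf_sum -etX.
  have eJJ : uone J *> ((uone J * uone K) *> (u.2 : P')) = (uone J * uone K) *> (u.2 : P').
    by rewrite lactA mulrA (uone_mulr (uone_in J)).
  rewrite -[in LHS]eJJ.
  set w := (_ *> u.2 : P').
  transitivity (val (b0' ((u.1 : extend Q') <* uone J) w)).
    by rewrite [RHS](prM (mcb eY)).
  rewrite eJ ract_sumr [LHS](pairing_suml _ _ _ (mcb eY)); apply: eq_bigr => v _.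
  by rewrite eb.
Qed.

End Composition.

Definition pib_comp (A B C : pzRingType) (X : pibimod A B) (Y : pibimod B C) :
  pibimod A C := PIBimod (comp_invertible X Y).

Lemma restr_equiv (A B : pzRingType) (M M' : bimodule A B)
    (I I' : uideal A) (J J' : uideal B) hl hr hl' hr'
    (h : invertible (@restr A B M I J hl hr))
    (h' : invertible (@restr A B M' I' J' hl' hr')) :
  I = I' -> J = J' -> isomorphic M M' -> pib_equiv (PIBimod h) (PIBimod h').
Proof.
move=> eI eJ [f [fD fl fr fb]].
move: I' eI hl' h' => _ <- hl' h'; move: J' eJ hr' h' => _ <- hr' h'.
constructor; exists f; split=> // [a|b] x; first exact: (fl (val a)).
exact: (fr (val b)).
Qed.

Lemma is_gamma_iso (I J : pzRingType) (P P' : bimodule I J) (g : {rmorphism 'Z(J) -> 'Z(I)}) :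
  isomorphic P P' -> is_gamma P g -> is_gamma P' g.
Proof.
case=> f [fD fl fr [f' fK f'K]] [gb gP]; split=> // b p.
by rewrite -[p]f'K -fl gP fr.
Qed.

Lemma central_ideal_eq (A : pzRingType) (I : uideal A) (z z' : 'Z(isub I))
    (zz : z * z = z) (zz' : z' * z' = z') :
  z = z' -> central_ideal zz = central_ideal zz'.
Proof. by move=> e; move: z' e zz' => _ <- zz'; congr central_ideal; exact: Prop_irrelevance. Qed.

Lemma pib_comp_equiv (A B C : pzRingType) (X X' : pibimod A B) (Y Y' : pibimod B C) :
  pib_equiv X X' -> pib_equiv Y Y' -> pib_equiv (pib_comp X Y) (pib_comp X' Y').
Proof.
case=> I J P P' iP iP' eP; case=> K L Q Q' iQ iQ' eQ.
apply: restr_equiv; last by apply: tensor_isomorphic; exact: isomorphic_extend.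
  apply: central_ideal_eq.
  have e := gamma_uniq iP' (is_gamma_iso eP (gammaP (PIBimod iP))) (gammaP (PIBimod iP')).
  by rewrite [LHS]e; apply: (congr1 (gamma (PIBimod iP'))); do 2!apply: val_inj.
apply: central_ideal_eq.
have e := gamma_uniq iQ' (is_gamma_iso eQ (gammaP (PIBimod iQ))) (gammaP (PIBimod iQ')).
have inj : injective (gamma (PIBimod iQ')) := can_inj (gammaK (PIBimod iQ')).
apply: inj; rewrite [RHS](gammaVK (PIBimod iQ')).
by rewrite -[LHS]e [LHS](gammaVK (PIBimod iQ)); do 2!apply: val_inj.
Qed.

Lemma pib_id_subproof (A : pzRingType) :
  invertible (restr (I := full_ideal A) (J := full_ideal A)
    (@lact1 _ _ (regular A)) (@ract1 _ _ (regular A))).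
Proof.
apply: (@restr_invertible A A (regular A) (regular A) (full_ideal A) (full_ideal A)
  _ _ (@lact1 _ _ (regular A)) (@ract1 _ _ (regular A)) *%R *%R).
- by split; [split|split| |] => * /=; rewrite ?mulrDl ?mulrDr ?mulrA.
- by exists [:: (1, 1)]; rewrite big_seq1 mulr1.
- by exists [:: (1, 1)]; rewrite big_seq1 mulr1.
Qed.

Definition pib_id (A : pzRingType) : pibimod A A := PIBimod (@pib_id_subproof A).

Record precategory := Precategory {
  ob : Type;
  hom : ob -> ob -> Type;
  idm : forall a, hom a a;
  compm : forall a b c, hom b c -> hom a b -> hom a c }.

Definition is_category (K : precategory) : Prop :=
  [/\ forall (a b c d : ob K) (h : hom c d) (g : hom b c) (f : hom a b),
        compm h (compm g f) = compm (compm h g) f,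
      forall (a b : ob K) (f : hom a b), compm (idm b) f = f &
      forall (a b : ob K) (f : hom a b), compm f (idm a) = f].

Definition is_inverse_category (K : precategory) : Prop :=
  is_category K /\
  forall (a b : ob K) (g : hom a b), exists! g' : hom b a,
    compm (compm g g') g = g /\ compm (compm g' g) g' = g'.

(* Classes are subsets of pibimod; an A-B-bimodule has domain B and codomain A. *)
Definition PIC_hom (B A : pzRingType) : Type :=
  {c : pibimod A B -> Prop | exists X, c = pib_equiv X}.

Definition PIC_class (A B : pzRingType) (X : pibimod A B) : PIC_hom B A :=
  exist _ (pib_equiv X) (ex_intro _ X erefl).

Definition PIC_repr (A B : pzRingType) (c : PIC_hom B A) : pibimod A B :=
  projT1 (cid (proj2_sig c)).

(* Independent of the chosen representatives: see PIC_compE. *)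
Definition PIC_comp (A B C : pzRingType) (c : PIC_hom B A) (d : PIC_hom C B) :
  PIC_hom C A := PIC_class (pib_comp (PIC_repr c) (PIC_repr d)).

Lemma PIC_classP (A B : pzRingType) (X Y : pibimod A B) :
  PIC_class X = PIC_class Y <-> pib_equiv X Y.
Proof.
split=> [/(congr1 sval)/= e|h].
  by move: (pib_equiv_refl Y); rewrite -e.
apply: eq_exist => /=; apply/funext => Z; apply/propext; split=> hZ.
  exact: pib_equiv_trans (pib_equiv_sym h) hZ.
exact: pib_equiv_trans h hZ.
Qed.

Lemma PIC_reprK (A B : pzRingType) (c : PIC_hom B A) : PIC_class (PIC_repr c) = c.
Proof.
case: c => c hc; apply: eq_exist; rewrite /PIC_repr; by case: cid.
Qed.

Lemma PIC_compE (A B C : pzRingType) (X : pibimod A B) (Y : pibimod B C) :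
  PIC_comp (PIC_class X) (PIC_class Y) = PIC_class (pib_comp X Y).
Proof.
by apply/PIC_classP; apply: pib_comp_equiv; apply/PIC_classP; exact: PIC_reprK.
Qed.

Definition PIC_cat : precategory :=
  @Precategory pzRingType PIC_hom (fun A => PIC_class (pib_id A))
    (fun C B A c d => PIC_comp c d).

(* Main.v *)
From mathcomp Require Import all_boot all_algebra.
Require Import Defs.

Set Implicit Arguments.
Unset Strict Implicit.
Unset Printing Implicit Defensive.

Import GRing.Theory.
Local Open Scope ring_scope.

(** Two ideas carry the proof.

    The first removes the unital ideals and the isomorphisms gamma from all
    computations.  A partially invertible I-J-bimodule P, for I in A and J in B,
    can be regarded as an A-B-bimodule [pib_ext], and nothing is lost: P is
    faithful over I, so 1_I is the least central idempotent of A that acts as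
    the identity, and I is recovered from the A-B-bimodule; likewise J.  So
    equality of classes is isomorphism of A-B-bimodules ([pib_equiv_ext]).  As
    the two ideals in a composite are chosen so that their identities act
    trivially on the tensor product, composition becomes the plain tensor
    product over the middle ring ([pib_ext_comp]).  The category axioms are then
    associativity and unitality of the tensor product.

    The second is the analogue for categories of the fact that a regular
    semigroup whose idempotents commute is an inverse semigroup
    ([inverse_category_criterion]).  The class of P is regular: for equivalence
    data (I, J, P, Q, alpha, beta), the composites of the classes of P and Q are
    the classes of I and of J, since P (x)_B Q is P (x)_J Q ([extend_tensor]),
    which alpha maps onto I; hence PQP = P and QPQ = Q ([pib_dual]).  Unital
    ideals of a fixed ring A, seen as A-A-bimodules, commute under the tensor
    product ([ideal_bim_comm]).  This is enough for all idempotents to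
    commute: in any category an idempotent x with inverse y is the product of xy
    and yx as soon as these two commute ([idempotent_factor]). *)

(** * Categories in which idempotents commute *)

Section InverseCategory.
Variables (K : precategory) (E : forall a : ob K, hom a a -> Prop).
Arguments E : clear implicits.
Hypothesis catK : is_category K.
Hypothesis E_comm :
  forall a (e f : hom a a), E a e -> E a f -> compm e f = compm f e.
Hypothesis E_regular : forall a b (g : hom a b), exists g' : hom b a,
  [/\ compm (compm g g') g = g, compm (compm g' g) g' = g',
      E b (compm g g') & E a (compm g' g)].

Let compA a b c d (h : hom c d) (g : hom b c) (f : @hom K a b) :
  compm h (compm g f) = compm (compm h g) f.
Proof. by case: catK. Qed.

(** If x has the inverse y, then y = yxy = (yx)(xy) because x is idempotent.
    This is a product of two commuting idempotents, so y is idempotent too, and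
    x = xyx = x(yy)x = (xy)(yx). *)
Lemma idempotent_factor a (x : @hom K a a) : compm x x = x ->
  exists e f, [/\ E a e, E a f & x = compm e f].
Proof.
move=> xx; have [y [xyx yxy Exy Eyx]] := E_regular x.
exists (compm x y), (compm y x); split=> //.
have ee : compm (compm x y) (compm x y) = compm x y by rewrite compA xyx.
have ff : compm (compm y x) (compm y x) = compm y x by rewrite compA yxy.
have y_fac : y = compm (compm y x) (compm x y).
  by rewrite compA -[compm (compm y x) x]compA xx yxy.
suff yy : compm y y = y by rewrite compA -[compm (compm x y) y]compA yy xyx.
rewrite y_fac; move: ee ff (E_comm Exy Eyx).
move: (compm x y) (compm y x) => e f ee ff ef.
by rewrite -{2}ef compA -[compm (compm f e) e]compA ee -compA ef compA ff.
Qed.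

Lemma idempotent_comm a (x y : @hom K a a) :
  compm x x = x -> compm y y = y -> compm x y = compm y x.
Proof.
move=> /idempotent_factor[e [f [Ee Ef ->]]] /idempotent_factor[g [h [Eg Eh ->]]].
rewrite compA -[compm (compm e f) g]compA (E_comm Ef Eg) compA (E_comm Ee Eg).
rewrite -[LHS]compA (E_comm Ef Eh) compA -[compm (compm g e) h]compA.
by rewrite (E_comm Ee Eh) !compA.
Qed.

(** Two inverses h and g' of g are both equal to g'gh: the idempotents gg' and
    gh commute, which turns g' = g'(gh)(gg') into g'gh, and dually g'g and hg
    commute. *)
Lemma inverse_category_criterion : is_inverse_category K.
Proof.
split=> // a b g; have [g' [gg'g g'gg' _ _]] := E_regular g.
exists g'; split=> // h [ghg hgh].
have l : compm (compm g g') (compm g h) = compm (compm g h) (compm g g').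
  by apply: idempotent_comm; rewrite compA ?gg'g ?ghg.
have r : compm (compm g' g) (compm h g) = compm (compm h g) (compm g' g).
  by apply: idempotent_comm; rewrite compA ?g'gg' ?hgh.
transitivity (compm (compm g' g) h).
  rewrite -{1}g'gg' -{1}ghg -!compA [compm h (compm g g')]compA.
  move: l; rewrite -!compA => <-.
  by rewrite !compA g'gg'.
rewrite -{2}hgh -{2}gg'g compA.
move: r; rewrite !compA => <-.
by rewrite -!compA [compm h (compm g h)]compA hgh.
Qed.

End InverseCategory.

(** * Tensor products of bimodules *)

(** Pure tensors generate and g is additive, so [g (f p q) = pure p q] already
    makes g a left inverse of [tlift f]. *)
Lemma tensor_iso (R S T : pzRingType) (P : bimodule R S) (Q : bimodule S T)
    (M : bimodule R T) (f : P -> Q -> M) (g : M -> tensor P Q) :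
  balanced f -> (forall a p q, f (a *> p) q = a *> f p q) ->
  (forall p q b, f p (q <* b) = f p q <* b) ->
  {morph g : x y / x + y} -> (forall p q, g (f p q) = pure p q) ->
  (forall m, tlift f (g m) = m) -> isomorphic (tensor P Q) M.
Proof.
move=> bal fl fr gD gf fg.
have fD := tliftD bal; have fp := tlift_pure bal.
have f0 : tlift f 0 = 0 by apply: (addrI (tlift f 0)); rewrite -fD !addr0.
have g0 : g 0 = 0 by apply: (addrI (g 0)); rewrite -gD !addr0.
exists (tlift f : tensor P Q -> M); split=> //.
- move=> a; elim/tens_ind => [|p q|x y hx hy].
  + by rewrite lact0 f0 lact0.
  + by rewrite lact_pure !fp fl.
  + by rewrite lactDr !fD hx hy lactDr.
- move=> b; elim/tens_ind => [|p q|x y hx hy].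
  + by rewrite ract0 f0 ract0.
  + by rewrite ract_pure !fp fr.
  + by rewrite ractDl !fD hx hy ractDl.
exists g => //; elim/tens_ind => [|p q|x y hx hy].
- by rewrite f0 g0.
- by rewrite fp gf.
- by rewrite fD gD hx hy.
Qed.

Lemma tensor_regular_l (R S : pzRingType) (P : bimodule R S) :
  isomorphic (tensor (regular R) P) P.
Proof.
have bal : balanced (fun (a : regular R) (p : P) => a *> p).
  by split=> *; rewrite ?lactDl ?lactDr // lactA.
apply: (@tensor_iso _ _ _ _ _ _ _ (fun p => pure (1 : regular R) p) bal).
- by move=> a x p; rewrite lactA.
- by move=> x p b; rewrite lractA.
- by move=> x y; rewrite pureDr.
- by move=> a p; rewrite -pureM /= mul1r.
- by move=> p; rewrite (tlift_pure bal) lact1.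
Qed.

Lemma tensor_regular_r (R S : pzRingType) (P : bimodule R S) :
  isomorphic (tensor P (regular S)) P.
Proof.
have bal : balanced (fun (p : P) (a : regular S) => p <* a).
  by split=> *; rewrite ?ractDl ?ractDr // ractA.
apply: (@tensor_iso _ _ _ _ _ _ _ (fun p => pure p (1 : regular S)) bal).
- by move=> a x p; rewrite lractA.
- by move=> x p b; rewrite ractA.
- by move=> x y; rewrite pureDl.
- by move=> p a; rewrite pureM /= mulr1.
- by move=> p; rewrite (tlift_pure bal) ract1.
Qed.

(** The map P x (Q (x) N) -> (P (x) Q) (x) N is itself obtained by factoring, for
    each p, the map (q, n) |-> (p (x) q) (x) n; likewise for the inverse. *)
Lemma tensorA (R S T U : pzRingType) (P : bimodule R S) (Q : bimodule S T)
    (N : bimodule T U) :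
  isomorphic (tensor P (tensor Q N)) (tensor (tensor P Q) N).
Proof.
pose M := tensor (tensor P Q) N; pose L := tensor P (tensor Q N).
have tlift0 R1 S1 T1 (P1 : bimodule R1 S1) (Q1 : bimodule S1 T1) (V : zmodType)
    (h : P1 -> Q1 -> V) (hb : balanced h) : tlift h 0 = 0.
  by apply: (addrI (tlift h 0)); rewrite -(tliftD hb) !addr0.
have bf p : balanced (fun q n => pure (pure p q : tensor P Q) n : M).
  by split=> *; rewrite ?pureDr ?pureDl // -ract_pure pureM.
have bg n : balanced (fun p q => pure p (pure q n : tensor Q N) : L).
  by split=> *; rewrite ?pureDr ?pureDl ?pureDr // pureM lact_pure.
pose f (p : P) (x : tensor Q N) : M :=
  tlift (fun q n => pure (pure p q : tensor P Q) n : M) x.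
pose g (y : tensor P Q) (n : N) : L :=
  tlift (fun p q => pure p (pure q n : tensor Q N) : L) y.
have fp p q n : f p (pure q n) = pure (pure p q : tensor P Q) n
  := tlift_pure (bf p) q n.
have gp p q n : g (pure p q) n = pure p (pure q n : tensor Q N)
  := tlift_pure (bg n) p q.
have f0 p : f p 0 = 0 := tlift0 _ _ _ _ _ _ _ (bf p).
have g0 n : g 0 n = 0 := tlift0 _ _ _ _ _ _ _ (bg n).
have fD p : {morph f p : x y / x + y} := tliftD (bf p).
have gD n x y : g (x + y) n = g x n + g y n := tliftD (bg n) x y.
have balf : balanced f.
  split=> [p p' x|p x y|p s x]; last 2 first; first by rewrite fD.
  - elim/tens_ind: x => [|q n|x y hx hy]; first by rewrite lact0 !f0.
      by rewrite lact_pure !fp pureM.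
    by rewrite lactDr !fD hx hy.
  elim/tens_ind: x => [|q n|x y hx hy]; first by rewrite !f0 addr0.
    by rewrite !fp !pureDl.
  by rewrite !fD hx hy addrACA.
have balg : balanced g.
  split=> [x y n|x n n'|x s n]; first by rewrite gD.
  - elim/tens_ind: x => [|p q|x y hx hy]; first by rewrite !g0 addr0.
      by rewrite !gp !pureDr.
    by rewrite !gD hx hy addrACA.
  elim/tens_ind: x => [|p q|x y hx hy]; first by rewrite ract0 !g0.
    by rewrite ract_pure !gp pureM.
  by rewrite ractDl !gD hx hy.
have F0 := tlift0 _ _ _ _ _ _ _ balf; have G0 := tlift0 _ _ _ _ _ _ _ balg.
apply: (@tensor_iso _ _ _ P (tensor Q N) M f (tlift g) balf).
- move=> a p x; elim/tens_ind: x => [|q n|x y hx hy]; first by rewrite !f0 lact0.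
    by rewrite !fp !lact_pure.
  by rewrite !fD hx hy lactDr.
- move=> p x b; elim/tens_ind: x => [|q n|x y hx hy].
  + by rewrite ract0 !f0 ract0.
  + by rewrite ract_pure !fp ract_pure.
  + by rewrite ractDl !fD hx hy ractDl.
- exact: tliftD.
- move=> p x; elim/tens_ind: x => [|q n|x y hx hy].
  + by rewrite f0 G0 pure0r.
  + by rewrite fp tlift_pure ?gp.
  + by rewrite fD tliftD ?hx ?hy ?pureDr.
elim/tens_ind => [|x n|x y hx hy]; first by rewrite G0 F0.
  rewrite (tlift_pure balg); elim/tens_ind: x => [|p q|x y hx hy].
  + by rewrite g0 F0 pure0l.
  + by rewrite gp (tlift_pure balf) fp.
  + by rewrite gD (tliftD balf) hx hy pureDl.
by rewrite (tliftD balg) (tliftD balf) hx hy.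
Qed.

(** * Extension to the ambient rings *)

(** The elements of B act on extend P and extend Q through their images in J, so
    balancedness over B and over J are the same condition and both tensor
    products have the same generators and relations. *)
Lemma extend_tensor (A B C : pzRingType) (I : uideal A) (J : uideal B)
    (L : uideal C) (P : bimodule (isub I) (isub J))
    (Q : bimodule (isub J) (isub L)) :
  isomorphic (tensor (extend P) (extend Q)) (extend (tensor P Q)).
Proof.
pose f (p : extend P) (q : extend Q) : extend (tensor P Q) :=
  pure (p : P) (q : Q).
have bal : balanced f.
  split=> [p p' q|p q q'|p s q]; rewrite /f; first exact: (@pureDl _ _ _ P).
    exact: (@pureDr _ _ _ P Q).
  exact: (@pureM _ _ _ P Q).
pose h (p : P) (q : Q) : tensor (extend P) (extend Q) :=
  pure (p : extend P) (q : extend Q).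
have bal' : balanced h.
  split=> [p p' q|p q q'|p s q]; first exact: (@pureDl _ _ _ (extend P)).
    exact: (@pureDr _ _ _ _ (extend Q)).
  have := @pureM _ _ _ (extend P) (extend Q) p (val s) q.
  by rewrite /= uprojK.
pose g : extend (tensor P Q) -> tensor (extend P) (extend Q) := tlift h.
have gD : {morph g : x y / x + y} := tliftD bal'.
have fD := tliftD bal.
have gp p q : g (f p q) = h p q := tlift_pure bal' p q.
have fp p q : tlift f (h p q) = f p q := tlift_pure bal p q.
have g0 : g 0 = 0 by apply: (addrI (g 0)); rewrite -gD !addr0.
have f0 : tlift f 0 = 0 by apply: (addrI (tlift f 0)); rewrite -fD !addr0.
apply: (@tensor_iso _ _ _ _ _ _ f g bal) => //.
- by move=> a p q; rewrite /f /= tens_lact_pure.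
- by move=> p q b; rewrite /f /= tens_ract_pure.
move=> m; elim/tens_ind: m => [|p q|x y hx hy]; first by rewrite g0 f0.
  by rewrite gp fp.
by rewrite gD fD hx hy.
Qed.

(** An element a of A acts on the left side as a 1_I, and 1_I acts as the
    identity on M. *)
Lemma extend_restr (A B : pzRingType) (M : bimodule A B) (I : uideal A)
    (J : uideal B) (hl : forall m : M, uone I *> m = m)
    (hr : forall m : M, m <* uone J = m) :
  isomorphic (extend (restr hl hr)) M.
Proof.
exists id; split=> // [a x|b x|]; last by exists id.
  by rewrite /= -lactA hl.
by rewrite /= -ractA hr.
Qed.

(** 1_I acts as the identity on the first bimodule, hence on the second one; as P'
    is faithful over I', this forces 1_I 1_I' = 1_I', so that 1_I' lies in I. *)
Lemma extend_iso_uone_l (A B : pzRingType) (I I' : uideal A) (J J' : uideal B)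
    (P : bimodule (isub I) (isub J)) (P' : bimodule (isub I') (isub J')) :
  isomorphic (extend P) (extend P') -> invertible P' -> uone I' \in uset I.
Proof.
case=> f [_ fl _ [g _ gK]] /invertible_faithful[faithful _].
have -> : uone I' = uone I * uone I'; last by rewrite uidealMr ?uone_in.
suff /(congr1 val) : 1 = uproj I' (uone I) by [].
apply: faithful => p; rewrite lact1 -[LHS](gK p).
by rewrite -[g p](extend_lact1 (P := P)) fl gK.
Qed.

Lemma extend_iso_uone_r (A B : pzRingType) (I I' : uideal A) (J J' : uideal B)
    (P : bimodule (isub I) (isub J)) (P' : bimodule (isub I') (isub J')) :
  isomorphic (extend P) (extend P') -> invertible P' -> uone J' \in uset J.
Proof.
case=> f [_ _ fr [g _ gK]] /invertible_faithful[_ faithful].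
have -> : uone J' = uone J * uone J'; last by rewrite uidealMr ?uone_in.
suff /(congr1 val) : 1 = uproj J' (uone J) by [].
apply: faithful => p; rewrite ract1 -[LHS](gK p).
by rewrite -[g p](extend_ract1 (P := P)) fr gK.
Qed.

Lemma uideal_eq_of_uone (A : pzRingType) (I I' : uideal A) :
  uone I \in uset I' -> uone I' \in uset I -> I = I'.
Proof.
move=> e e'; apply: uideal_ext => x; apply/idP/idP => xI.
  by rewrite -(uone_mulr xI) uidealMl.
by rewrite -(uone_mulr xI) uidealMl.
Qed.

Lemma isomorphic_of_extend (A B : pzRingType) (I : uideal A) (J : uideal B)
    (P P' : bimodule (isub I) (isub J)) :
  isomorphic (extend P) (extend P') -> isomorphic P P'.
Proof.
case=> f [fD fl fr fb]; exists f; split=> // [a|b] x.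
  by have := fl (val a) x; rewrite /= !uprojK.
by have := fr (val b) x; rewrite /= !uprojK.
Qed.

(** * Partially invertible bimodules up to isomorphism *)

Definition pib_ext (A B : pzRingType) (X : pibimod A B) : bimodule A B :=
  extend (pib_P X).

(** The ideals on both sides contain the identities of each other, so they
    coincide. *)
Lemma pib_equiv_ext (A B : pzRingType) (X Y : pibimod A B) :
  pib_equiv X Y <-> isomorphic (pib_ext X) (pib_ext Y).
Proof.
split=> [[I J P P' iP iP' h]|]; first exact: isomorphic_extend.
case: X Y => I J P iP [I' J' P' iP']; rewrite /pib_ext /= => h.
have h' := isomorphic_sym h.
have eI : I = I'.
  apply: uideal_eq_of_uone; first exact: extend_iso_uone_l h' iP.
  exact: extend_iso_uone_l h iP'.
have eJ : J = J'.
  apply: uideal_eq_of_uone; first exact: extend_iso_uone_r h' iP.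
  exact: extend_iso_uone_r h iP'.
move: P' iP' h {h'}; case: _ / eI; case: _ / eJ => P' iP' h.
by constructor; exact: isomorphic_of_extend.
Qed.

(** The composite is by construction the tensor product over B, restricted to
    ideals whose identities act trivially on it. *)
Lemma pib_ext_comp (A B C : pzRingType) (X : pibimod A B) (Y : pibimod B C) :
  isomorphic (pib_ext (pib_comp X Y)) (tensor (pib_ext X) (pib_ext Y)).
Proof. exact: extend_restr. Qed.

Lemma pib_ext_id (A : pzRingType) : isomorphic (pib_ext (pib_id A)) (regular A).
Proof. exact: extend_restr. Qed.

Lemma pib_compA (A B C D : pzRingType) (X : pibimod A B) (Y : pibimod B C)
    (Z : pibimod C D) :
  pib_equiv (pib_comp X (pib_comp Y Z)) (pib_comp (pib_comp X Y) Z).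
Proof.
apply/pib_equiv_ext; apply: isomorphic_trans (pib_ext_comp _ _) _.
apply: isomorphic_trans; last exact: isomorphic_sym (pib_ext_comp _ _).
apply: isomorphic_trans (tensor_isomorphic (isomorphic_refl _) (pib_ext_comp _ _)) _.
apply: isomorphic_trans (tensorA _ _ _) _.
exact: isomorphic_sym (tensor_isomorphic (pib_ext_comp _ _) (isomorphic_refl _)).
Qed.

Lemma pib_comp1l (A B : pzRingType) (X : pibimod A B) :
  pib_equiv (pib_comp (pib_id A) X) X.
Proof.
apply/pib_equiv_ext; apply: isomorphic_trans (pib_ext_comp _ _) _.
apply: isomorphic_trans (tensor_isomorphic (pib_ext_id _) (isomorphic_refl _)) _.
exact: tensor_regular_l.
Qed.

Lemma pib_comp1r (A B : pzRingType) (X : pibimod A B) :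
  pib_equiv (pib_comp X (pib_id B)) X.
Proof.
apply/pib_equiv_ext; apply: isomorphic_trans (pib_ext_comp _ _) _.
apply: isomorphic_trans (tensor_isomorphic (isomorphic_refl _) (pib_ext_id _)) _.
exact: tensor_regular_r.
Qed.

Lemma PIC_hom_ind (A B : pzRingType) (G : PIC_hom B A -> Prop) :
  (forall X : pibimod A B, G (PIC_class X)) -> forall c, G c.
Proof. by move=> h c; rewrite -(PIC_reprK c). Qed.

Lemma PIC_category : is_category PIC_cat.
Proof.
split=> [D C B A|B A|B A]; rewrite /=.
- elim/PIC_hom_ind=> X; elim/PIC_hom_ind=> Y; elim/PIC_hom_ind=> Z.
  by rewrite !PIC_compE; apply/PIC_classP; exact: pib_compA.
- elim/PIC_hom_ind=> X; rewrite PIC_compE; apply/PIC_classP; exact: pib_comp1l.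
- elim/PIC_hom_ind=> X; rewrite PIC_compE; apply/PIC_classP; exact: pib_comp1r.
Qed.

(** * Unital ideals as commuting idempotents *)

Definition ideal_bim (A : pzRingType) (I : uideal A) : bimodule A A :=
  extend (regular (isub I)).

(** Stated up to isomorphism of A-A-bimodules, so that the composite of a class
    with its dual qualifies without a comparison of ideals. *)
Definition is_ideal_class (A : pzRingType) (c : PIC_hom A A) : Prop :=
  exists X (I : uideal A), c = PIC_class X /\ isomorphic (pib_ext X) (ideal_bim I).

Lemma isub_mul_uone_r (A : pzRingType) (I : uideal A) (x : isub I) a :
  val x * (a * uone I) = val x * a.
Proof. by rewrite mulrA uone_mulr // uidealMr ?isub_valP. Qed.

Lemma isub_mul_uone_l (A : pzRingType) (I : uideal A) a (x : isub I) :
  a * uone I * val x = a * val x.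
Proof. by rewrite -mulrA uone_mull ?isub_valP. Qed.

(** The exchange of x (x) y for y (x) x is not balanced over A in general.  But
    x (x) y = xy (x) 1_J, where xy lies in both I and J; for z in both ideals,
    the map defined here sends z (x) 1_J to z (x) 1_I. *)
Definition swap_ideals (A : pzRingType) (I J : uideal A) (x : ideal_bim I)
    (y : ideal_bim J) : tensor (ideal_bim J) (ideal_bim I) :=
  @pure _ _ _ (ideal_bim J) (ideal_bim I)
    (uproj J (isub_val x * isub_val y)) (1 : isub I).

Lemma swap_ideals_balanced (A : pzRingType) (I J : uideal A) :
  balanced (@swap_ideals A I J).
Proof.
rewrite /swap_ideals; split=> [x x' y|x y y'|x a y].
- by rewrite -pureDl /= mulrDl raddfD.
- by rewrite -pureDl /= mulrDr raddfD.
congr (pure _ _); congr uproj => /=.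
by rewrite (isub_mul_uone_r x) (isub_mul_uone_l a y) mulrA.
Qed.

(** Swapping twice takes x (x) y to xy (x) 1_J, and y moves back across the
    tensor sign. *)
Lemma swap_idealsK (A : pzRingType) (I J : uideal A) (x : ideal_bim I)
    (y : ideal_bim J) :
  @swap_ideals A J I (uproj J (isub_val x * isub_val y)) (1 : isub I) = pure x y.
Proof.
have -> : pure x y = @pure _ _ _ (ideal_bim I) (ideal_bim J)
    (x <* isub_val y) (1 : isub J).
  by rewrite pureM /= uprojK mulr1.
have xyI : isub_val x * isub_val y * uone I = isub_val x * isub_val y.
  by rewrite uone_mulr ?uidealMr ?isub_valP.
have xyJ : isub_val x * isub_val y * uone J = isub_val x * isub_val y.
  by rewrite uone_mulr ?uidealMl ?isub_valP.
by congr (pure _ _); apply: val_inj; rewrite /= xyJ mulrA !xyI.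
Qed.

Lemma ideal_bim_comm (A : pzRingType) (I J : uideal A) :
  isomorphic (tensor (ideal_bim I) (ideal_bim J))
             (tensor (ideal_bim J) (ideal_bim I)).
Proof.
have bal := @swap_ideals_balanced A.
have zero I1 J1 : tlift (@swap_ideals A I1 J1) 0 = 0.
  by apply: (addrI (tlift (@swap_ideals A I1 J1) 0)); rewrite -(tliftD (bal _ _)) !addr0.
have swapK I1 J1 : cancel (tlift (@swap_ideals A I1 J1) : tensor _ _ -> tensor _ _)
    (tlift (@swap_ideals A J1 I1)).
  elim/tens_ind=> [|x y|x y hx hy]; first by rewrite !zero.
    by rewrite !(tlift_pure (bal _ _)) swap_idealsK.
  by rewrite !(tliftD (bal _ _)) hx hy.
apply: (@tensor_iso _ _ _ _ _ _ (@swap_ideals A I J) (tlift (@swap_ideals A J I)) (bal I J)).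
- move=> a x y; rewrite /swap_ideals lact_pure; congr (pure _ _) => /=.
  by rewrite -rmorphM isub_mul_uone_l mulrA.
- move=> x y b; rewrite /swap_ideals ract_pure.
  have -> : @ract _ _ (ideal_bim I) (1 : isub I) b =
      @lact _ _ (ideal_bim I) b (1 : isub I).
    by rewrite /= mul1r mulr1.
  by rewrite -pureM; congr (pure _ _); rewrite /= -rmorphM isub_mul_uone_r mulrA.
- exact: tliftD.
- by move=> x y; rewrite -(tlift_pure (bal I J)) swapK.
- exact: swapK.
Qed.

Lemma is_ideal_class_comm (A : pzRingType) (c d : PIC_hom A A) :
  is_ideal_class c -> is_ideal_class d -> PIC_comp c d = PIC_comp d c.
Proof.
move=> [X [I [-> iX]]] [Y [J [-> iY]]]; rewrite !PIC_compE.
apply/PIC_classP/pib_equiv_ext.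
apply: isomorphic_trans (pib_ext_comp _ _) _.
apply: isomorphic_trans (tensor_isomorphic iX iY) _.
apply: isomorphic_trans (ideal_bim_comm _ _) _.
apply: isomorphic_trans (tensor_isomorphic (isomorphic_sym iY) (isomorphic_sym iX)) _.
exact: isomorphic_sym (pib_ext_comp _ _).
Qed.

Lemma ideal_bim_lunit (A B : pzRingType) (I : uideal A) (J : uideal B)
    (P : bimodule (isub I) (isub J)) :
  isomorphic (tensor (ideal_bim I) (extend P)) (extend P).
Proof.
apply: isomorphic_trans (extend_tensor _ _) _.
exact: isomorphic_extend (tensor_regular_l _).
Qed.

(** The dual of P is the bimodule Q of its equivalence data: alpha identifies
    P (x) Q with I, beta identifies Q (x) P with J, and these are units for P and
    Q. *)
Lemma pib_dual (A B : pzRingType) (X : pibimod A B) : exists Y : pibimod B A,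
  [/\ pib_equiv (pib_comp (pib_comp X Y) X) X,
      pib_equiv (pib_comp (pib_comp Y X) Y) Y,
      is_ideal_class (PIC_class (pib_comp X Y)) &
      is_ideal_class (PIC_class (pib_comp Y X))].
Proof.
case: X => I J P iP; have [Q [al [be [hal hbe hab hba]]]] := iP.
have iQ : invertible Q by exists P, be, al; split.
pose X := PIBimod iP; pose Y := PIBimod iQ.
have eXY : isomorphic (pib_ext (pib_comp X Y)) (ideal_bim I).
  apply: isomorphic_trans (pib_ext_comp X Y) _.
  apply: isomorphic_trans (extend_tensor P Q) _.
  by apply: isomorphic_extend; exists al.
have eYX : isomorphic (pib_ext (pib_comp Y X)) (ideal_bim J).
  apply: isomorphic_trans (pib_ext_comp Y X) _.
  apply: isomorphic_trans (extend_tensor Q P) _.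
  by apply: isomorphic_extend; exists be.
exists Y; split.
- apply/pib_equiv_ext; apply: isomorphic_trans (pib_ext_comp _ _) _.
  apply: isomorphic_trans (tensor_isomorphic eXY (isomorphic_refl _)) _.
  exact: ideal_bim_lunit.
- apply/pib_equiv_ext; apply: isomorphic_trans (pib_ext_comp _ _) _.
  apply: isomorphic_trans (tensor_isomorphic eYX (isomorphic_refl _)) _.
  exact: ideal_bim_lunit.
- by exists (pib_comp X Y), I.
- by exists (pib_comp Y X), J.
Qed.

Theorem theorem28 : is_inverse_category PIC_cat.
Proof.
apply: (@inverse_category_criterion PIC_cat is_ideal_class PIC_category).
  exact: is_ideal_class_comm.
move=> B A; elim/PIC_hom_ind=> X; have [Y [XYX YXY eXY eYX]] := pib_dual X.
exists (PIC_class Y); rewrite /= !PIC_compE.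
by split=> //; apply/PIC_classP.
Qed.
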